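(* Let $n\ge2$ and let $(M,0)$ be a $2n$-dimensional formal submanifold of $\mathbb{C}^{n+1}$ defined by the formal equation $$w=q(z,\overline z)+p(z,\overline z)+iE(z,\overline z),\qquad q(z,\overline z)=\sum_{i=1}^n\big(|z_i|^2+\lambda_i(z_i^2+\overline{z_i}^2)\big),$$ where $0\le\lambda_1,\dots,\lambda_n<\infty$ and $p,E$ are real-valued formal power series in $(z,\overline z)$ of order at least $3$. Suppose that there exists $i\in[1,n]$ with $\lambda_i\neq\frac12$, and that $M$ is formally non-minimal. Then for any positive integer $N$ there exists a holomorphic transformation of the special form $(z,w)\mapsto(z'=z,\ w'=w+o(|z|^2,w))$ such that in the new coordinates $M$ is defined by an equation of the form $w'=\rho(z',\overline{z'})$ with $\mathrm{Im}\,\rho$ vanishing at least to order $N$.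
   Context: Coordinates on $\mathbb{C}^{n+1}$ are $(z,w)=(z_1,\dots,z_n,w)$. The notation $o(|z|^2,w)$ denotes a holomorphic function near $0$ that is $o(|z|^2+|w|)$ as $(z,w)\to0$. Notation. $G=q+p$. For a function or formal series $\chi(z,\overline z)$ write $\chi_\alpha=\partial\chi/\partial z_\alpha$ and $\chi_{\overline\alpha}=\partial\chi/\partial\overline{z_\alpha}$. For $1\le j\le n-1$ put $$A=G_n-iE_n,\quad B_{(j)}=G_j-iE_j,\quad C_{(j)}=2i(G_nE_j-G_jE_n),$$ and for $1\le j,k\le n-1$ $$\lambda_{(1jk)}=A(\overline A)_j-B_{(j)}(\overline A)_n,\quad \lambda_{(2jk)}=-A(\overline{B_{(k)}})_j+B_{(j)}(\overline{B_{(k)}})_n,\quad \lambda_{(3jk)}=A(\overline{C_{(k)}})_j-B_{(j)}(\overline{C_{(k)}})_n,$$ $$\lambda_{(4jk)}=-\overline A\,A_{\overline k}+\overline{B_{(k)}}A_{\overline n},\quad \lambda_{(5jk)}=\overline A(B_{(j)})_{\overline k}-\overline{B_{(k)}}(B_{(j)})_{\overline n},\quad \lambda_{(6jk)}=-\overline A(C_{(j)})_{\overline k}+\overline{B_{(k)}}(C_{(j)})_{\overline n}.$$ Also put $\Gamma_{(i)}=A(\lambda_{(i11)})_1-B_{(1)}(\lambda_{(i11)})_n$ for $i=1,2,3$. $M$ is called formally non-minimal if the following identities hold as formal power series in $(z,\overline z)$: (a) for all $2\le j,k\le n-1$: $(\overline A\lambda_{(2jk)}+\overline{B_{(k)}}\lambda_{(1jk)})(A\lambda_{(611)}-C_{(1)}\lambda_{(411)})=(\overline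 A\lambda_{(211)}+\overline{B_{(1)}}\lambda_{(111)})(A\lambda_{(6jk)}-C_{(j)}\lambda_{(4jk)})$; (b) for all $2\le k\le n-1$: $(\overline A\lambda_{(21k)}+\overline{B_{(k)}}\lambda_{(11k)})(A\lambda_{(611)}-C_{(1)}\lambda_{(411)})=(\overline A\lambda_{(211)}+\overline{B_{(1)}}\lambda_{(111)})(A\lambda_{(61k)}-C_{(1)}\lambda_{(41k)})$; (c) $(\overline A\,\Gamma_{(2)}+\Gamma_{(1)}\overline{B_{(1)}})(\overline A\lambda_{(311)}-\lambda_{(111)}\overline{C_{(1)}})=(\overline A\,\Gamma_{(3)}-\Gamma_{(1)}\overline{C_{(1)}})(\overline A\lambda_{(211)}+\lambda_{(111)}\overline{B_{(1)}})$. *)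

(* Defs.v *)
From HB Require Import structures.
From mathcomp Require Import all_boot all_order all_algebra.
(* [mpoly] has to be imported before the analysis files: in the other order
   their notations clash. *)
From mathcomp Require Import complex mpoly.
From mathcomp Require Import boolp classical_sets reals topology normedtype.
From mathcomp Require Import landau.

Set Implicit Arguments.
Unset Strict Implicit.
Unset Printing Implicit Defensive.

Import Order.TTheory GRing.Theory Num.Theory.
Import numFieldNormedType.Exports.

Local Open Scope classical_set_scope.
Local Open Scope ring_scope.

(* A series is its family of coefficients; [f m] is the coefficient of X^m. *)
Record fps (k : nat) (K : Type) := Fps { fps_coef :> 'X_{1..k} -> K }.

Lemma fpsP (k : nat) (K : Type) (f g : fps k K) : f =1 g -> f = g.
Proof. by case: f => f; case: g => g /= /funext ->. Qed.

HB.instance Definition _ (k : nat) (K : Type) := gen_eqMixin (fps k K).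
HB.instance Definition _ (k : nat) (K : Type) := gen_choiceMixin (fps k K).

Section Ring.
Variables (k : nat) (K : comNzRingType).
Implicit Types (f g h : fps k K) (c : K).

Definition fps0 : fps k K := Fps (fun=> 0).
Definition fps1 : fps k K := Fps (fun m => (m == 0%MM)%:R).
Definition fps_opp f : fps k K := Fps (fun m => - f m).
Definition fps_add f g : fps k K := Fps (fun m => f m + g m).
Definition fps_mul f g : fps k K :=
  Fps (fun m => \sum_(ij : 'X_{1..k < (mdeg m).+1, (mdeg m).+1}
                      | m == (ij.1 + ij.2)%MM) f ij.1 * g ij.2).
Definition fps_scale c f : fps k K := Fps (fun m => c * f m).

Fact fps_addA : associative fps_add.
Proof. by move=> f g h; apply: fpsP => m /=; rewrite addrA. Qed.
Fact fps_addC : commutative fps_add.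
Proof. by move=> f g; apply: fpsP => m /=; rewrite addrC. Qed.
Fact fps_add0 : left_id fps0 fps_add.
Proof. by move=> f; apply: fpsP => m /=; rewrite add0r. Qed.
Fact fps_addN : left_inverse fps0 fps_opp fps_add.
Proof. by move=> f; apply: fpsP => m /=; rewrite addNr. Qed.

HB.instance Definition _ :=
  GRing.isZmodule.Build (fps k K) fps_addA fps_addC fps_add0 fps_addN.

Definition fps_trunc (d : nat) f : {mpoly K[k]} :=
  \sum_(m : 'X_{1..k < d}) f m *: 'X_[m].

Lemma fps_truncE d f m : (mdeg m < d)%N -> (fps_trunc d f)@_m = f m.
Proof. exact: mcoeff_mpoly. Qed.

Lemma fps_mulE d f g m : (mdeg m < d)%N ->
  fps_mul f g m = (fps_trunc d f * fps_trunc d g)@_m.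
Proof.
move=> lt_md; rewrite mcoeffM /=; apply: eq_bigr => -[i j] /= _.
by rewrite !fps_truncE // (leq_trans (bmdeg _)).
Qed.

Lemma mcoeffM_eq (p p' r r' : {mpoly K[k]}) m :
    (forall l, (mdeg l <= mdeg m)%N -> p@_l = p'@_l) ->
    (forall l, (mdeg l <= mdeg m)%N -> r@_l = r'@_l) ->
  (p * r)@_m = (p' * r')@_m.
Proof.
move=> eqp eqr; rewrite !mcoeffM; apply: eq_bigr => -[i j] /= _.
by rewrite eqp ?eqr // -ltnS bmdeg.
Qed.

Fact fps_mulA : associative fps_mul.
Proof.
move=> f g h; apply: fpsP => m; set d := (mdeg m).+1.
rewrite !(@fps_mulE d) //.
transitivity ((fps_trunc d f * (fps_trunc d g * fps_trunc d h))@_m).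
  apply: mcoeffM_eq => // l le_lm.
  by rewrite fps_truncE ?ltnS // (@fps_mulE d) ?ltnS.
rewrite mulrA; apply: mcoeffM_eq => // l le_lm.
by rewrite fps_truncE ?ltnS // (@fps_mulE d) ?ltnS.
Qed.

Fact fps_mulC : commutative fps_mul.
Proof.
move=> f g; apply: fpsP => m.
by rewrite !(@fps_mulE (mdeg m).+1) // mulrC.
Qed.

Fact fps_mul1 : left_id fps1 fps_mul.
Proof.
move=> f; apply: fpsP => m; rewrite (@fps_mulE (mdeg m).+1) //.
rewrite -[RHS](@fps_truncE (mdeg m).+1) // -[in RHS](mul1r (fps_trunc _ _)).
by apply: mcoeffM_eq => // l le_lm; rewrite fps_truncE ?ltnS // mcoeff1.
Qed.

Fact fps_mulD : left_distributive fps_mul fps_add.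
Proof.
move=> f g h; apply: fpsP => m /=; rewrite -big_split /=.
by apply: eq_bigr => ij _; rewrite mulrDl.
Qed.

Fact fps_1neq0 : fps1 != 0.
Proof.
apply/eqP => /(congr1 (fun f : fps k K => f 0%MM)) /=.
by rewrite eqxx => /eqP; rewrite oner_eq0.
Qed.

HB.instance Definition _ := GRing.Zmodule_isComNzRing.Build (fps k K)
  fps_mulA fps_mulC fps_mul1 fps_mulD fps_1neq0.

Fact fps_scaleA a b f : fps_scale a (fps_scale b f) = fps_scale (a * b) f.
Proof. by apply: fpsP => m /=; rewrite mulrA. Qed.
Fact fps_scale1 : left_id 1 fps_scale.
Proof. by move=> f; apply: fpsP => m /=; rewrite mul1r. Qed.
Fact fps_scaleDr : right_distributive fps_scale +%R.
Proof. by move=> a f g; apply: fpsP => m /=; rewrite mulrDr. Qed.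
Fact fps_scaleDl f : {morph fps_scale^~ f : a b / a + b}.
Proof. by move=> a b; apply: fpsP => m /=; rewrite mulrDl. Qed.

HB.instance Definition _ := GRing.Zmodule_isLmodule.Build K (fps k K)
  fps_scaleA fps_scale1 fps_scaleDr fps_scaleDl.

Fact fps_scaleAl c f g : c *: (f * g) = (c *: f) * g.
Proof.
apply: fpsP => m /=; rewrite mulr_sumr.
by apply: eq_bigr => ij _; rewrite mulrA.
Qed.

HB.instance Definition _ :=
  GRing.Lmodule_isLalgebra.Build K (fps k K) fps_scaleAl.
HB.instance Definition _ :=
  GRing.Lalgebra_isComAlgebra.Build K (fps k K).

Definition fps_var (i : 'I_k) : fps k K := Fps (fun m => (m == U_(i)%MM)%:R).

Definition fps_deriv (i : 'I_k) f : fps k K :=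
  Fps (fun m => f (m + U_(i))%MM *+ (m i).+1).

Definition fps_order_ge (N : nat) f : Prop :=
  forall m : 'X_{1..k}, (mdeg m < N)%N -> f m = 0.

End Ring.

(* [fps_comp f g] = f(g_1, ..., g_l), for g_1, ..., g_l without constant term:
   then the product of the (g_i)^(a_i) has order at least |a|, so that only the
   exponents a with |a| <= |m| contribute to the coefficient of X^m. *)
Definition fps_comp (k l : nat) (K : comNzRingType)
    (f : fps l K) (g : 'I_l -> fps k K) : fps k K :=
  Fps (fun m => \sum_(a : 'X_{1..l < (mdeg m).+1})
                  f a * (\prod_(i < l) g i ^+ a i) m).

Section Germ.
Variables (K : numFieldType) (l : nat).

Definition monomial_at (a : 'X_{1..l}) (x : 'rV[K]_l) : K :=
  \prod_(i < l) x 0 i ^+ a i.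

Definition partial_sum (f : fps l K) (x : 'rV[K]_l) (d : nat) : K :=
  \sum_(a : 'X_{1..l < d}) f a * monomial_at a x.

Definition partial_abs_sum (f : fps l K) (x : 'rV[K]_l) (d : nat) : K :=
  \sum_(a : 'X_{1..l < d}) `|f a * monomial_at a x|.

(* [F] is holomorphic near 0, with Taylor series [f] at 0. *)
Definition has_taylor_series (F : 'rV[K]_l -> K) (f : fps l K) : Prop :=
  \forall x \near (0 : 'rV[K]_l),
    cvgn (partial_abs_sum f x) /\ partial_sum f x d @[d --> \oo] --> F x.

End Germ.

(* Points of C^(n+1) are row vectors of size n + 1; the coordinates are
   z_i = x 0 (lshift 1 i) and w = x 0 (rshift n 0). *)
Definition z_w_weight (K : numFieldType) (n : nat) (x : 'rV[K]_(n + 1)) : K :=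
  \sum_(i < n) `|x 0 (lshift 1 i)| ^+ 2 + `|x 0 (rshift n ord0)|.

Definition little_o_z2_w (K : numFieldType) (n : nat)
    (F : 'rV[K]_(n + 1) -> K) : Prop :=
  F =o_ (nbhs (0 : 'rV[K]_(n + 1))) (@z_w_weight K n).

Section RealFormal.
Variables (R : realType) (n : nat).
Local Notation C := R[i].
Local Notation series := (fps (n + n) C).
Implicit Types (chi : series) (i : 'I_n).

(* The variables with index [lshift n i] stand for z_i, those with index
   [rshift n i] for the conjugate of z_i. *)
Definition z_ i : series := fps_var C (lshift n i).
Definition zbar_ i : series := fps_var C (rshift n i).

Definition d_z i chi : series := fps_deriv (lshift n i) chi.
Definition d_zbar i chi : series := fps_deriv (rshift n i) chi.

Definition swap_bar (i : 'I_(n + n)) : 'I_(n + n) :=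
  match split i with inl j => rshift n j | inr j => lshift n j end.

Definition fps_conj chi : series :=
  Fps (fun m => (chi [multinom m (swap_bar i) | i < n + n])^*).

Definition real_valued chi : Prop := fps_conj chi = chi.

Definition fps_Im chi : series := (2 * 'i)^-1 *: (chi - fps_conj chi).

Definition quadric (lambda : 'I_n -> R) : series :=
  \sum_(i < n) (z_ i * zbar_ i
                + (lambda i)%:C%C *: (z_ i ^+ 2 + zbar_ i ^+ 2)).

(* [restrict_to_graph f phi] = f(z, phi(z, zbar)). *)
Definition restrict_to_graph (f : fps (n + 1) C) (phi : series) : series :=
  fps_comp f (fun l => match split l with inl j => z_ j | inr _ => phi end).

(* The image of the formal submanifold w = phi(z, zbar) under z' = z,
   w' = w + f(z, w) has the equation w' = rho(z', zbar'): the series w' - rho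
   vanishes identically on the submanifold. *)
Definition transformed_equation (phi : series) (f : fps (n + 1) C)
    (rho : series) : Prop :=
  phi + restrict_to_graph f phi = rho.

End RealFormal.

Section NonMinimal.
Variables (R : realType) (n : nat) (n_gt1 : (1 < n)%N).
Local Notation C := R[i].
Local Notation series := (fps (n + n) C).
Implicit Types (j k : 'I_n).

(* Indices are shifted by one: the coordinates z_1, ..., z_n are numbered from
   0 to n - 1. *)
Definition idx1 : 'I_n := Ordinal (ltnW n_gt1).

Fact idxn_subproof : (n.-1 < n)%N.
Proof. by rewrite prednK // ltnW. Qed.
Definition idxn : 'I_n := Ordinal idxn_subproof.

Variables G E : series.

Local Notation bar := (@fps_conj R n).
Local Notation d := (@d_z R n).
Local Notation db := (@d_zbar R n).
Local Notation e1 := idx1.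
Local Notation n_ := idxn.

Definition nm_A : series := d n_ G - 'i *: d n_ E.
Definition nm_B j : series := d j G - 'i *: d j E.
Definition nm_C j : series := (2 * 'i) *: (d n_ G * d j E - d j G * d n_ E).

Local Notation A := nm_A.
Local Notation B := nm_B.
Local Notation Cc := nm_C.

Definition nm_lambda1 j k : series := A * d j (bar A) - B j * d n_ (bar A).
Definition nm_lambda2 j k : series :=
  - A * d j (bar (B k)) + B j * d n_ (bar (B k)).
Definition nm_lambda3 j k : series :=
  A * d j (bar (Cc k)) - B j * d n_ (bar (Cc k)).
Definition nm_lambda4 j k : series := - bar A * db k A + bar (B k) * db n_ A.
Definition nm_lambda5 j k : series :=
  bar A * db k (B j) - bar (B k) * db n_ (B j).
Definition nm_lambda6 j k : series :=
  - bar A * db k (Cc j) + bar (B k) * db n_ (Cc j).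

Local Notation l1 := nm_lambda1.
Local Notation l2 := nm_lambda2.
Local Notation l3 := nm_lambda3.
Local Notation l4 := nm_lambda4.
Local Notation l6 := nm_lambda6.

(* [nm_Gamma (nm_lambda{i} idx1 idx1)] is Gamma_(i), for i = 1, 2, 3. *)
Definition nm_Gamma (l : series) : series := A * d e1 l - B e1 * d n_ l.

Local Notation Gamma1 := (nm_Gamma (l1 e1 e1)).
Local Notation Gamma2 := (nm_Gamma (l2 e1 e1)).
Local Notation Gamma3 := (nm_Gamma (l3 e1 e1)).

Definition formally_non_minimal : Prop :=
  [/\ forall j k, j != e1 -> j != n_ -> k != e1 -> k != n_ ->
        (bar A * l2 j k + bar (B k) * l1 j k)
          * (A * l6 e1 e1 - Cc e1 * l4 e1 e1)
        = (bar A * l2 e1 e1 + bar (B e1) * l1 e1 e1)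
          * (A * l6 j k - Cc j * l4 j k),
      forall k, k != e1 -> k != n_ ->
        (bar A * l2 e1 k + bar (B k) * l1 e1 k)
          * (A * l6 e1 e1 - Cc e1 * l4 e1 e1)
        = (bar A * l2 e1 e1 + bar (B e1) * l1 e1 e1)
          * (A * l6 e1 k - Cc e1 * l4 e1 k)
    & (bar A * Gamma2 + Gamma1 * bar (B e1))
        * (bar A * l3 e1 e1 - l1 e1 e1 * bar (Cc e1))
      = (bar A * Gamma3 - Gamma1 * bar (Cc e1))
        * (bar A * l2 e1 e1 + l1 e1 e1 * bar (B e1))].

End NonMinimal.

(* Main.v *)
(* Write psi for the conjugate of phi = G + iE. The series A, B_(j) are the
   derivatives of psi and C_(j) is the derivative of phi along the (1,0) vector
   field L_j = A d_j - B_(j) d_n of M. After simplification, (a) and (b) say that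
   the Hessians of phi and of psi, restricted to the CR tangent directions, are
   proportional, and (c) says that a 3 x 3 Wronskian along L_1 vanishes. In this
   form non-minimality is preserved by w' = w + f(z, w), so it suffices to remove
   the lowest order part e of Im phi.

   The leading terms of the conditions say that e and q have proportional Hessians
   along the leaves of q, with a factor c. The latter is
   a polynomial, by divisibility properties of linear forms (the hypothesis
   lambda_i <> 1/2 matters only here, and only for n = 2), and the functions
   e_j - c q_j are holomorphic along the leaves. Then c satisfies the same
   equations as e, and an induction on the degree gives e = 2 Re F(z, q) with F a
   weighted homogeneous polynomial; f = - 2 i F removes e. *)
Require Import Defs.
From HB Require Import structures.
From mathcomp Require Import all_boot all_order all_algebra perm.
From mathcomp Require Import complex mpoly ssrcomplements ring.
From mathcomp Require Import boolp classical_sets reals topology normedtype.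
From mathcomp Require landau.

Set Implicit Arguments.
Unset Strict Implicit.
Unset Printing Implicit Defensive.

Import Order.TTheory GRing.Theory Num.Theory.
Import numFieldNormedType.Exports.

Local Open Scope ring_scope.

(** The obstacle is the polynomiality of c. It is a quotient by D, the Hessian of q along L_1, and D
    may be reducible, so the only tool is to cancel linear forms l in D | l p. For n >= 3 the
    proportionality provides such a relation. For n = 2 it is void, and the Wronskian condition
    gives a relation that contains the derivative of D along L_1. If both lambda_i vanish, so does
    this derivative, and an Euler operator takes over; if both are 1/2, it vanishes as well and D
    splits into linear forms, the case that the hypothesis excludes.

    The corrections of all orders are evaluated on the original graph, never on the corrected one:
    they add up to a single polynomial in (z, w), and no coordinate changes are composed. As N is
    finite, a polynomial suffices and convergence is immediate. With weight 2 for w, F(z, q) is the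
    leading part of F(z, phi) when F is weighted homogeneous; weight above 2 both keeps the
    quadratic part q and makes f an o(|z|^2 + |w|). *)

(** * Chain rule and conjugation for polynomials *)

Lemma mpoly_ring_ind (R : comNzRingType) (k : nat) (P : {mpoly R[k]} -> Prop) :
  (forall c, P c%:MP) -> (forall i, P 'X_i) ->
  (forall p q, P p -> P q -> P (p + q)) ->
  (forall p q, P p -> P q -> P (p * q)) -> forall p, P p.
Proof.
move=> PC PX PD PM p; rewrite [p]mpolyE.
elim: (msupp p) => [|m s IHs]; first by rewrite big_nil -mpolyC0.
rewrite big_cons; apply: (PD) => {IHs}//; rewrite -mul_mpolyC; apply: (PM) => //.
rewrite mpolyXE_id; apply: big_ind => [||i _]; [by rewrite -mpolyC1|exact: PM|].
by elim: (m i) => [|e IHe]; rewrite ?expr0 -?mpolyC1 // exprS; apply: (PM).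
Qed.

Lemma mderivXU (R : nzRingType) (k : nat) (i j : 'I_k) :
  ('X_j : {mpoly R[k]})^`M(i) = (j == i)%:R.
Proof.
rewrite mderivX mnm1E; case: eqP => [->|_]; last by rewrite scale0r.
have -> : (U_(i) - U_(i) = 0 :> 'X_{1..k})%MM.
  by apply/mnmP => l; rewrite mnmBE mnm0E subnn.
by rewrite mpolyX0 scale1r.
Qed.

(** Chain rule, for an abstract derivation of the target: it serves the substitution of q as well as
    that of a formal series. *)
Lemma deriv_mmap (R S : comNzRingType) (k : nat) (f : {rmorphism R -> S})
    (h : 'I_k -> S) (d : S -> S) :
    (forall x y, d (x + y) = d x + d y) ->
    (forall x y, d (x * y) = d x * y + x * d y) ->
    (forall c, d (f c) = 0) ->
  forall p, d (mmap f h p) = \sum_i mmap f h p^`M(i) * d (h i).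
Proof.
move=> dD dM dC; elim/mpoly_ring_ind => [c|i|p q IHp IHq|p q IHp IHq].
- by rewrite mmapC dC big1 // => i _; rewrite mderivC mmap0 mul0r.
- rewrite mmapX mmap1U (bigD1 i) //= mderivXU eqxx rmorph1 mul1r.
  rewrite big1 ?addr0 // => j ne_ji.
  by rewrite mderivXU eq_sym (negPf ne_ji) mmap0 mul0r.
- rewrite mmapD dD IHp IHq -big_split /=; apply: eq_bigr => i _.
  by rewrite mderivD mmapD mulrDl.
- rewrite rmorphM dM IHp IHq mulr_suml mulr_sumr -big_split /=.
  apply: eq_bigr => i _; rewrite mderivM mmapD !rmorphM /=; ring.
Qed.

Lemma swap_barK n : involutive (@swap_bar n).
Proof.
move=> i; rewrite /swap_bar; case: (split_ordP i) => j ->.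
  by case: split_ordP => l /eqP; rewrite ?eq_shift // => /eqP ->.
by case: split_ordP => l /eqP; rewrite ?eq_shift // => /eqP ->.
Qed.

Lemma swap_bar_lshift n (j : 'I_n) : swap_bar (lshift n j) = rshift n j.
Proof.
by rewrite /swap_bar; case: split_ordP => l /eqP; rewrite ?eq_shift // => /eqP ->.
Qed.

Lemma swap_bar_rshift n (j : 'I_n) : swap_bar (rshift n j) = lshift n j.
Proof. by rewrite -swap_bar_lshift swap_barK. Qed.

Definition mnm_swap n (m : 'X_{1..n + n}) : 'X_{1..n + n} :=
  [multinom m (swap_bar i) | i < n + n].

Lemma mnm_swapD n (l m : 'X_{1..n + n}) :
  mnm_swap (l + m) = (mnm_swap l + mnm_swap m)%MM.
Proof. by apply/mnmP => i; rewrite !(mnmE, mnmDE). Qed.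

Lemma mnm_swapU n (i : 'I_(n + n)) : mnm_swap U_(i)%MM = U_(swap_bar i)%MM.
Proof.
apply/mnmP => j; rewrite mnmE !mnm1E; congr nat_of_bool.
by apply/eqP/eqP => [->|<-]; rewrite swap_barK.
Qed.

Section Conj.
Variables (K : numClosedFieldType) (n : nat).
Implicit Types p q : {mpoly K[n + n]}.

Definition swap_perm : 'S_(n + n) := perm (inv_inj (@swap_barK n)).

Fact mpoly_conj_key : unit. Proof. by []. Qed.
Definition mpoly_conj : {mpoly K[n + n]} -> {mpoly K[n + n]} :=
  locked_with mpoly_conj_key
    (fun p => map_mpoly (@Num.conj K) (msym swap_perm p)).

Fact mpoly_conj_is_zmod_morphism : zmod_morphism mpoly_conj.
Proof. by move=> p q; rewrite /mpoly_conj unlock !rmorphB. Qed.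
Fact mpoly_conj_is_monoid_morphism : monoid_morphism mpoly_conj.
Proof.
by split=> [|p q]; rewrite /mpoly_conj unlock ?rmorph1 ?rmorphM.
Qed.
HB.instance Definition _ :=
  GRing.isZmodMorphism.Build _ _ mpoly_conj mpoly_conj_is_zmod_morphism.
HB.instance Definition _ :=
  GRing.isMonoidMorphism.Build _ _ mpoly_conj mpoly_conj_is_monoid_morphism.

Lemma mcoeff_conj m p : (mpoly_conj p)@_m = (p@_(mnm_swap m))^*.
Proof.
rewrite /mpoly_conj unlock mcoeff_map_mpoly mcoeff_sym; congr (_@__)^*.
by apply/mnmP => i; rewrite !mnmE permE.
Qed.

Lemma mpoly_conjK : involutive mpoly_conj.
Proof.
move=> p; apply/mpolyP => m; rewrite !mcoeff_conj conjCK; congr (_@__).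
by apply/mnmP => i; rewrite !mnmE swap_barK.
Qed.

Lemma mpoly_conjC c : mpoly_conj c%:MP = (c^*)%:MP.
Proof.
apply/mpolyP => m; rewrite mcoeff_conj !mcoeffC rmorphM rmorph_nat.
congr (_ * (_ : bool)%:R); apply/eqP/eqP => /mnmP e; apply/mnmP => i.
  by have := e (swap_bar i); rewrite mnmE swap_barK !mnm0E.
by rewrite mnmE e !mnm0E.
Qed.

Lemma mpoly_conjX i : mpoly_conj 'X_i = 'X_(swap_bar i).
Proof.
apply/mpolyP => m; rewrite mcoeff_conj !mcoeffX rmorph_nat.
congr ((_ : bool)%:R); apply/eqP/eqP => [e|<-]; last first.
  by rewrite mnm_swapU swap_barK.
rewrite -mnm_swapU e; apply/mnmP => j; by rewrite !mnmE swap_barK.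
Qed.

Lemma mderiv_conj i p : (mpoly_conj p)^`M(i) = mpoly_conj p^`M(swap_bar i).
Proof.
apply/mpolyP => m; rewrite mcoeff_conj !mcoeff_deriv mcoeff_conj rmorphMn /=.
by rewrite mnm_swapD mnm_swapU mnmE swap_barK.
Qed.

End Conj.

(** * Polynomials in z and its conjugate *)

Section Divisibility.
Variables (K : fieldType) (k : nat).
Implicit Types l p q r d : {mpoly K[k]}.

Definition mdvd p q := exists r, q = p * r.

Definition mprime l := forall p q, mdvd l (p * q) -> mdvd l p \/ mdvd l q.

Lemma mdvd_root l p (x : 'I_k -> K) : mdvd l p -> l.@[x] = 0 -> p.@[x] = 0.
Proof. by case=> r -> lx0; rewrite rmorphM /= lx0 mul0r. Qed.

(** The substitution [s] is the identity modulo l and kills l, so l generates its kernel, which is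
    prime because the target is a domain. In the applications [u] is the inverse of the coefficient
    of ['X_i] in a linear form l, and [s] solves l = 0 for that variable. *)
Lemma mprime_subst l (i : 'I_k) (u : K) :
    mmap (@mpolyC k K) (fun j => 'X_j - u%:MP * l *+ (j == i)) l = 0 ->
  mprime l.
Proof.
set h := fun j => _; set s := mmap _ h => sl0.
have modl p : mdvd l (p - s p).
  elim/mpoly_ring_ind: p => [c|j|p q [p' ep] [q' eq]|p q [p' ep] [q' eq]].
  - by exists 0; rewrite /s mmapC subrr mulr0.
  - exists (u%:MP *+ (j == i)).
    by rewrite /s mmapX mmap1U opprB addrC subrK mulrnAr mulrC.
  - exists (p' + q'); rewrite mulrDr -ep -eq /s mmapD; ring.
  - exists (p' * q + s p * q'); rewrite /s rmorphM /=.
    rewrite -[mmap _ _ p]/(s p) -[mmap _ _ q]/(s q).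
    transitivity ((p - s p) * q + s p * (q - s q)); first by ring.
    by rewrite ep eq; ring.
move=> p q [r epq]; have : s p * s q = 0.
  by rewrite -rmorphM /= epq rmorphM /= -/s sl0 mul0r.
move/eqP; rewrite mulf_eq0 => /orP[]/eqP s0; [left|right].
  by have := modl p; rewrite s0 subr0.
by have := modl q; rewrite s0 subr0.
Qed.

(** In l p = d r the prime l divides r, since it does not divide d. Only l has to be prime:
    [levi_det] can be reducible. *)
Lemma mdvd_cancel l d p :
  mprime l -> l != 0 -> ~ mdvd l d -> mdvd d (l * p) -> mdvd d p.
Proof.
move=> prl l0 ndv [r e]; have [|//|[r' er]] := prl d r; first by exists p.
exists r'; apply: (mulfI l0); rewrite e er; ring.
Qed.

End Divisibility.

Section Quadric.
Variables (K : numClosedFieldType) (n : nat) (lam : 'I_n -> K).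
Hypothesis lam_ge0 : forall i, 0 <= lam i.
Implicit Types (p : {mpoly K[n + n]}) (i j : 'I_n).

Local Notation poly := {mpoly K[n + n]}.
Local Notation cj := (@mpoly_conj K n).

Definition Z j : poly := 'X_(lshift n j).
Definition Zb j : poly := 'X_(rshift n j).
(** The derivatives of [qq], which are linear forms. *)
Definition qz j : poly := Zb j + 2 * (lam j)%:MP * Z j.
Definition qb j : poly := Z j + 2 * (lam j)%:MP * Zb j.
Definition qq : poly :=
  \sum_i (Z i * Zb i + (lam i)%:MP * (Z i ^+ 2 + Zb i ^+ 2)).
(* Locked: otherwise comparing two derivatives unfolds their computation. *)
Fact dz_key : unit. Proof. by []. Qed.
Fact db_key : unit. Proof. by []. Qed.
Definition dz : 'I_n -> poly -> poly :=
  locked_with dz_key (fun j p => p^`M(lshift n j)).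
Definition db : 'I_n -> poly -> poly :=
  locked_with db_key (fun j p => p^`M(rshift n j)).

Lemma dzE j p : dz j p = p^`M(lshift n j). Proof. by rewrite /dz unlock. Qed.
Lemma dbE j p : db j p = p^`M(rshift n j). Proof. by rewrite /db unlock. Qed.

Lemma lam_real i : (lam i)^* = lam i.
Proof. exact/CrealP/ger0_real. Qed.

Lemma conj_Z j : cj (Z j) = Zb j.
Proof. by rewrite /Z mpoly_conjX swap_bar_lshift. Qed.
Lemma conj_Zb j : cj (Zb j) = Z j.
Proof. by rewrite -conj_Z mpoly_conjK. Qed.
Lemma conj_qz j : cj (qz j) = qb j.
Proof.
by rewrite /qz rmorphD !rmorphM rmorph_nat /= conj_Z conj_Zb mpoly_conjC lam_real.
Qed.
Lemma conj_qb j : cj (qb j) = qz j.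
Proof. by rewrite -conj_qz mpoly_conjK. Qed.
Lemma conj_dz j p : cj (dz j p) = db j (cj p).
Proof. by rewrite dzE dbE mderiv_conj swap_bar_rshift. Qed.
Lemma conj_db j p : cj (db j p) = dz j (cj p).
Proof. by rewrite dzE dbE mderiv_conj swap_bar_lshift. Qed.
Lemma conj_qq : cj qq = qq.
Proof.
rewrite rmorph_sum; apply: eq_bigr => i _.
rewrite rmorphD !rmorphM rmorphD !rmorphXn /= mpoly_conjC lam_real conj_Z conj_Zb.
ring.
Qed.

Lemma dzD j : {morph dz j : x y / x + y}.
Proof. by move=> x y; rewrite !dzE mderivD. Qed.
Lemma dzB j : {morph dz j : x y / x - y}.
Proof. by move=> x y; rewrite !dzE mderivB. Qed.
Lemma dzM j x y : dz j (x * y) = dz j x * y + x * dz j y.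
Proof. by rewrite !dzE mderivM. Qed.
Lemma dz_C j c : dz j c%:MP = 0.
Proof. by rewrite dzE mderivC. Qed.
Lemma dbD j : {morph db j : x y / x + y}.
Proof. by move=> x y; rewrite !dbE mderivD. Qed.
Lemma dbB j : {morph db j : x y / x - y}.
Proof. by move=> x y; rewrite !dbE mderivB. Qed.
Lemma dbM j x y : db j (x * y) = db j x * y + x * db j y.
Proof. by rewrite !dbE mderivM. Qed.
Lemma db_C j c : db j c%:MP = 0.
Proof. by rewrite dbE mderivC. Qed.
Lemma dz_db i j p : dz i (db j p) = db j (dz i p).
Proof. by rewrite !dzE !dbE mderiv_comm. Qed.
Lemma db_db i j p : db i (db j p) = db j (db i p).
Proof. by rewrite !dbE mderiv_comm. Qed.

Lemma dz_Z i j : dz i (Z j) = (j == i)%:R.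
Proof. by rewrite dzE mderivXU (inj_eq (@lshift_inj _ _)). Qed.
Lemma dz_Zb i j : dz i (Zb j) = 0.
Proof. by rewrite dzE mderivXU eq_rlshift. Qed.
Lemma db_Z i j : db i (Z j) = 0.
Proof. by rewrite dbE mderivXU eq_lrshift. Qed.
Lemma db_Zb i j : db i (Zb j) = (j == i)%:R.
Proof. by rewrite dbE mderivXU (inj_eq (@rshift_inj _ _)). Qed.

Lemma two_mpolyC : 2 = 2%:MP :> poly. Proof. by rewrite mpolyC_nat. Qed.

Lemma dz_qz i j : dz i (qz j) = 2 * (lam j)%:MP * (j == i)%:R.
Proof. by rewrite /qz two_mpolyC !(dzD, dzM, dz_C, dz_Z, dz_Zb); ring. Qed.
Lemma db_qz i j : db i (qz j) = (j == i)%:R.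
Proof. by rewrite /qz two_mpolyC !(dbD, dbM, db_C, db_Z, db_Zb); ring. Qed.
Lemma dz_qb i j : dz i (qb j) = (j == i)%:R.
Proof. by rewrite /qb two_mpolyC !(dzD, dzM, dz_C, dz_Z, dz_Zb); ring. Qed.
Lemma db_qb i j : db i (qb j) = 2 * (lam j)%:MP * (j == i)%:R.
Proof. by rewrite /qb two_mpolyC !(dbD, dbM, db_C, db_Z, db_Zb); ring. Qed.

Lemma dz_qq j : dz j qq = qz j.
Proof.
rewrite /qq dzE raddf_sum (bigD1 j) //= big1 => [|i /negPf ne_ij].
  rewrite -dzE expr2 expr2 !(dzD, dzM, dz_C, dz_Z, dz_Zb) eqxx /qz /=; ring.
rewrite -dzE expr2 expr2 !(dzD, dzM, dz_C, dz_Z, dz_Zb) ne_ij /=; ring.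
Qed.
Lemma db_qq j : db j qq = qb j.
Proof. by rewrite -[qq]conj_qq -conj_dz dz_qq conj_qz. Qed.

Definition zpoint (f g : 'I_n -> K) (l : 'I_(n + n)) : K :=
  match split l with inl j => f j | inr j => g j end.

Lemma meval_Z f g j : (Z j).@[zpoint f g] = f j.
Proof.
rewrite mevalXU /zpoint; case: split_ordP => l /eqP; rewrite eq_shift //.
by move/eqP->.
Qed.
Lemma meval_Zb f g j : (Zb j).@[zpoint f g] = g j.
Proof.
rewrite mevalXU /zpoint; case: split_ordP => l /eqP; rewrite eq_shift //.
by move/eqP->.
Qed.
Lemma meval_qz f g j : (qz j).@[zpoint f g] = g j + 2 * lam j * f j.
Proof.
by rewrite rmorphD !rmorphM /= meval_Z meval_Zb mevalC rmorph_nat.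
Qed.
Lemma meval_qb f g j : (qb j).@[zpoint f g] = f j + 2 * lam j * g j.
Proof.
by rewrite rmorphD !rmorphM /= meval_Z meval_Zb mevalC rmorph_nat.
Qed.

Lemma qz_lin_prime (a b : K) i j : i != j -> b != 0 ->
  mprime (a%:MP * qz i + b%:MP * qz j).
Proof.
move=> ne_ij b0; apply: (@mprime_subst _ _ _ (rshift n j) b^-1).
set l := a%:MP * _ + _; rewrite {2}/l /qz !(rmorphD, rmorphM, rmorph1) /=.
rewrite !mmapC !mmapX !mmap1U !eq_lrshift !(inj_eq (@rshift_inj _ _)) eqxx.
rewrite (negPf ne_ij) !mulr0n mulr1n !subr0.
transitivity (l - (b%:MP * b^-1%:MP) * l); first by rewrite /l /qz /Z /Zb; ring.
by rewrite -mpolyCM mulfV // mpolyC1 mul1r subrr.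
Qed.

Lemma qz_prime j : mprime (qz j).
Proof.
apply: (@mprime_subst _ _ _ (rshift n j) 1).
rewrite {2}/qz rmorphD !rmorphM rmorph_nat /= !mmapC !mmapX !mmap1U.
by rewrite eq_lrshift eqxx mulr0n mulr1n mpolyC1 /qz /Z /Zb; ring.
Qed.

Lemma mdvd_conj p q : mdvd p q -> mdvd (cj p) (cj q).
Proof. by case=> r ->; exists (cj r); rewrite rmorphM. Qed.

Lemma qb_prime j : mprime (qb j).
Proof.
move=> p q /mdvd_conj; rewrite conj_qb rmorphM => /qz_prime[]/mdvd_conj;
  rewrite !mpoly_conjK conj_qz; by [left|right].
Qed.

Lemma lin_lam_gt0 i : 0 < 1 + 2 * lam i.
Proof. by rewrite ltr_pwDl // mulr_ge0. Qed.

Lemma qz_neq0 j : qz j != 0.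
Proof.
apply/eqP => /(congr1 (meval (zpoint (fun=> 1) (fun=> 1)))).
by rewrite meval_qz meval0 mulr1 => /eqP; rewrite gt_eqF ?lin_lam_gt0.
Qed.
Lemma qb_neq0 j : qb j != 0.
Proof.
apply/eqP => /(congr1 (meval (zpoint (fun=> 1) (fun=> 1)))).
by rewrite meval_qb meval0 mulr1 => /eqP; rewrite gt_eqF ?lin_lam_gt0.
Qed.

(** The forms [qb i0] and [qb i1] are coprime, so a vector parallel to the conjugate gradient of q
    is a polynomial multiple of it. *)
Lemma qb_ratio (x : 'I_n -> poly) i0 i1 : i0 != i1 ->
    (forall k l, x k * qb l = x l * qb k) ->
  exists y, forall k, x k = y * qb k.
Proof.
move=> ne01 ex; have [|[y ey]|] := @qb_prime i1 (x i1) (qb i0).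
- by exists (x i0); rewrite ex mulrC.
- exists y => k; apply: (mulIf (qb_neq0 i1)); rewrite ex ey; ring.
move/(@mdvd_root _ _ _ _ (zpoint (fun j => (j == i0)%:R) (fun=> 0))).
rewrite !meval_qb eqxx eq_sym (negPf ne01) !mulr0 !addr0 => /(_ erefl)/eqP.
by rewrite oner_eq0.
Qed.

Lemma qz_ratio (x : 'I_n -> poly) i0 i1 : i0 != i1 ->
    (forall k l, x k * qz l = x l * qz k) ->
  exists y, forall k, x k = y * qz k.
Proof.
move=> ne01 ex; have [|y ey] := @qb_ratio (cj \o x) i0 i1 ne01.
  by move=> k l; rewrite /= -!conj_qz -!rmorphM ex.
exists (cj y) => k; have /= := congr1 cj (ey k).
by rewrite mpoly_conjK rmorphM /= conj_qb.
Qed.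

(** The Hessian of q on the vector [qz j] d_i - [qz i] d_j tangent to its leaves; the mixed second
    derivatives of q form the identity matrix. *)
Definition levi_det i j : poly := qz i * qb i + qz j * qb j.

Lemma levi_det_conj i j : cj (levi_det i j) = levi_det i j.
Proof.
rewrite /levi_det rmorphD !rmorphM /= !conj_qz !conj_qb; ring.
Qed.

Lemma meval_levi_det f g i j : (levi_det i j).@[zpoint f g] =
  (g i + 2 * lam i * f i) * (f i + 2 * lam i * g i)
  + (g j + 2 * lam j * f j) * (f j + 2 * lam j * g j).
Proof. by rewrite rmorphD !rmorphM /= !meval_qz !meval_qb. Qed.

(** At this point [qz k] and [qb k] vanish for k other than j, while the determinant is (1 + 2 lam
    j)^2; so none of these forms divides it. *)
Lemma levi_det_eval_neq0 i j : i != j ->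
  (levi_det i j).@[zpoint (fun l => (l == j)%:R) (fun l => (l == j)%:R)] != 0.
Proof.
move=> ne_ij; rewrite meval_levi_det eqxx (negPf ne_ij) /=.
by rewrite !(mulr0, addr0, add0r, mulr1) mulf_neq0 // gt_eqF ?lin_lam_gt0.
Qed.

End Quadric.

(** * The Euler operator in two of the variables *)

Lemma mcoeff_mulX_mderiv (R : comNzRingType) k (p : {mpoly R[k]}) (i : 'I_k) m :
  ('X_i * p^`M(i))@_m = p@_m *+ m i.
Proof.
elim/mpolyind: p => [|c l p _ _ IHp].
  by rewrite mderiv0 mulr0 !mcoeff0 mul0rn.
rewrite mderivD mulrDr !mcoeffD IHp mulrnDl; congr (_ + _).
rewrite mderivZ mderivX -!scalerAr !mcoeffZ -mulrnAr; congr (_ * _).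
rewrite -mpolyXD !mcoeffX; case: (posnP (l i)) => [l0|l_gt0].
  by rewrite l0 mul0r; case: eqP => [<-|_]; rewrite ?l0 ?mul0rn.
have -> : (U_(i) + (l - U_(i)) = l)%MM by rewrite addmC submK // lep1mP -lt0n.
by case: eqP => [->|_]; rewrite ?mulr1 ?mulr0 ?mul0rn.
Qed.

Section Euler.
Variables (K : numFieldType) (k : nat) (i j : 'I_k).
Implicit Types p : {mpoly K[k]}.

Definition euler p : {mpoly K[k]} := 'X_i * p^`M(i) + 'X_j * p^`M(j).

(** Monomials are eigenvectors, with natural numbers as eigenvalues; hence 1 + [euler] and 2 +
    [euler] are bijective in characteristic 0. *)
Lemma mcoeff_euler p m : (euler p)@_m = p@_m *+ (m i + m j).
Proof. by rewrite mcoeffD !mcoeff_mulX_mderiv mulrnDr. Qed.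

Lemma eulerM p q : euler (p * q) = euler p * q + p * euler q.
Proof. rewrite /euler !mderivM; ring. Qed.

Lemma add_euler_inj p : p + euler p = 0 -> p = 0.
Proof.
move=> e; apply/mpolyP => m; apply/eqP; rewrite mcoeff0.
have /eqP := congr1 (mcoeff m) e.
by rewrite mcoeffD mcoeff_euler -mulrS mcoeff0 mulrn_eq0.
Qed.

Lemma add2_euler_surj p : exists q, q *+ 2 + euler q = p.
Proof.
elim/mpolyind: p => [|c m p _ _ [q eq]].
  by exists 0; rewrite mul0rn /euler !mderiv0 !mulr0 !addr0.
exists ((c / (2 + m i + m j)%N%:R) *: 'X_[m] + q); rewrite -eq.
transitivity (((c / (2 + m i + m j)%N%:R) *: 'X_[m]) *+ (2 + m i + m j)
              + (q *+ 2 + euler q)); last first.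
  by rewrite -scaler_nat scalerA mulrC divfK // pnatr_eq0.
apply/mpolyP => l; rewrite !(mcoeffMn, mcoeff_euler, mcoeffD) -!mulrnDr.
rewrite mulrnDl addnA mcoeffZ mcoeffX.
by case: eqP => [->//|_]; rewrite mulr0 !mul0rn.
Qed.

End Euler.

(** * Divisibility by the Levi determinant *)

Section LeviDivisibility.
Variables (K : numClosedFieldType) (n : nat) (lam : 'I_n -> K).
Hypothesis lam_ge0 : forall i, 0 <= lam i.
Implicit Types (i j : 'I_n).

Local Notation poly := {mpoly K[n + n]}.
Local Notation qz := (qz lam).
Local Notation qb := (qb lam).
Local Notation levi_det := (levi_det lam).

Implicit Types p H E : poly.

Lemma levi_detC i j : levi_det i j = levi_det j i.
Proof. exact: addrC. Qed.

Lemma mdvd_cancel_qz i j p :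
  i != j -> mdvd (levi_det i j) (qz i * p) -> mdvd (levi_det i j) p.
Proof.
move=> ne_ij; apply: mdvd_cancel; [exact: qz_prime|exact: qz_neq0|].
move/(@mdvd_root _ _ _ _
  (zpoint (fun l => (l == j)%:R) (fun l => (l == j)%:R))).
rewrite meval_qz (negPf ne_ij) mulr0 addr0 => /(_ erefl)/eqP.
by rewrite (negPf (levi_det_eval_neq0 _ ne_ij)).
Qed.

Lemma mdvd_cancel_qb i j k p : i != j -> k != j ->
  mdvd (levi_det i j) (qb k * p) -> mdvd (levi_det i j) p.
Proof.
move=> ne_ij ne_kj; apply: mdvd_cancel; [exact: qb_prime|exact: qb_neq0|].
move/(@mdvd_root _ _ _ _
  (zpoint (fun l => (l == j)%:R) (fun l => (l == j)%:R))).
rewrite meval_qb (negPf ne_kj) mulr0 addr0 => /(_ erefl)/eqP.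
by rewrite (negPf (levi_det_eval_neq0 _ ne_ij)).
Qed.

(* For [lam j <> 1/2] the forms [qz j] and [qb j] are linearly independent: the
   first linear form has a zero with [qb j = 0] at which [levi_det i j] does not
   vanish. *)
Lemma mdvd_cancel_qz_lin i j (a b : K) p :
    i != j -> (a != 0) || (b != 0) -> (lam i = 0 -> a = 0) -> lam j != 2^-1 ->
    mdvd (levi_det i j) ((a%:MP * qz j + b%:MP * qz i) * p) ->
  mdvd (levi_det i j) p.
Proof.
move=> ne_ij nz_ab lam_i lam_j; apply: mdvd_cancel.
- have [b0|/negPf b0] := eqVneq b 0; last first.
    by apply: qz_lin_prime; rewrite ?b0 // eq_sym.
  by rewrite addrC; apply: qz_lin_prime => //; rewrite b0 eqxx orbF in nz_ab.
- apply/eqP => l0; move: nz_ab.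
  have ev f g : a * (g j + 2 * lam j * f j) + b * (g i + 2 * lam i * f i) = 0.
    rewrite -!meval_qz -[LHS](_ : (a%:MP * qz j + b%:MP * qz i).@[zpoint f g] = _).
      by rewrite l0 meval0.
    by rewrite rmorphD !rmorphM /= !mevalC.
  have := ev (fun=> 0) (fun l => (l == i)%:R).
  have := ev (fun=> 0) (fun l => (l == j)%:R).
  rewrite !eqxx (negPf ne_ij) eq_sym (negPf ne_ij) /= !(mulr0, addr0, add0r, mulr1).
  by move=> -> ->; rewrite eqxx.
have [a0|a_neq0] := eqVneq a 0.
  rewrite a0 mpolyC0 mul0r add0r.
  move/(@mdvd_root _ _ _ _
  (zpoint (fun l => (l == j)%:R) (fun l => (l == j)%:R))).
  rewrite rmorphM /= meval_qz (negPf ne_ij) !mulr0 addr0 mulr0 => /(_ erefl)/eqP.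
  by rewrite (negPf (levi_det_eval_neq0 _ ne_ij)).
have nz_lam : lam i != 0 by apply: contra_neq a_neq0.
(* At the point used below, [qz j] is -b, [qz i] is a and [qb j] is 0: the linear form vanishes
   there and [levi_det i j] is 2 (lam i) a^2. *)
pose t := - b / (1 - (2 * lam j) ^+ 2).
have nz : 1 - (2 * lam j) ^+ 2 != 0.
  have -> : 1 - (2 * lam j) ^+ 2 = (1 - 2 * lam j) * (1 + 2 * lam j) by ring.
  rewrite mulf_neq0 ?(gt_eqF (lin_lam_gt0 _ _)) // subr_eq0.
  apply: contra_neq lam_j => e.
  by rewrite -[LHS](@mulKf _ 2) ?pnatr_eq0 // -e mulr1.
move/(@mdvd_root _ _ _ _ (zpoint (fun l => - (2 * lam j * t) *+ (l == j))
                                (fun l => if l == j then t else a))).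
rewrite rmorphD !rmorphM /= !mevalC meval_levi_det !meval_qz eqxx (negPf ne_ij) /=.
rewrite mulr0n mulr1n !(mulr0, addr0, add0r).
have -> : t + 2 * lam j * - (2 * lam j * t) = - b.
  have <- : t * (1 - (2 * lam j) ^+ 2) = - b by rewrite /t mulfVK.
  ring.
rewrite mulrN mulrC addNr => /(_ erefl)/eqP.
rewrite addNr mulr0 addr0 !mulf_eq0 (negPf a_neq0) (negPf nz_lam).
by rewrite pnatr_eq0.
Qed.

(* Modulo [levi_det i j], the product of [qz i] with the last factor is
   [- qb j * (lam i * qz j ^ 2 + lam j * qz i ^ 2)], and the quadratic form splits
   into two linear ones. *)
Lemma levi_dvd_generic i j H : i != j ->
    (lam i != 0) || (lam j != 0) -> (lam i != 2^-1) || (lam j != 2^-1) ->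
    mdvd (levi_det i j) (qb j * H *
      ((lam i)%:MP * qz j * qb i - (lam j)%:MP * qz i * qb j)) ->
  mdvd (levi_det i j) H.
Proof.
move=> ne_ij nz nh.
set a := sqrtC (lam i); set b := 'i * sqrtC (lam j).
have a2 : a ^+ 2 = lam i by rewrite sqrtCK.
have b2 : b ^+ 2 = - lam j by rewrite exprMn sqrCi sqrtCK mulN1r.
have canc (s : bool) p :
    mdvd (levi_det i j) ((a%:MP * qz j + ((-1) ^+ s * b)%:MP * qz i) * p) ->
    mdvd (levi_det i j) p.
  have nz_ab : (a != 0) || ((-1) ^+ s * b != 0).
    rewrite mulf_eq0 signr_eq0 /=.
    by rewrite -[a == 0](expf_eq0 _ 2) -[b == 0](expf_eq0 _ 2) a2 b2 oppr_eq0.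
  (* Whichever coefficient differs from 1/2 takes the place of [lam j] in [mdvd_cancel_qz_lin]. *)
  case/orP: nh => [lam_i|lam_j].
    rewrite levi_detC addrC; apply: mdvd_cancel_qz_lin => //.
    - by rewrite eq_sym.
    - by rewrite orbC.
    - move=> lj0; apply/eqP; rewrite mulf_eq0 signr_eq0 /=.
      by rewrite -[b == 0](expf_eq0 _ 2) b2 lj0 oppr0.
  apply: mdvd_cancel_qz_lin => // li0.
  by apply/eqP; rewrite -[_ == 0](expf_eq0 _ 2) a2 li0.
case=> r er; have ji : j != i by rewrite eq_sym.
apply: (canc false); apply: (canc true); rewrite levi_detC.
apply: (@mdvd_cancel_qb j i j) => //; apply: (@mdvd_cancel_qb j i j) => //.
rewrite levi_detC !expr1 expr0 mul1r mulN1r.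
have -> : (- b)%:MP = - b%:MP :> poly by rewrite mpolyCN.
exists (qb j * H * (lam i)%:MP * qz j - qz i * r).
transitivity (qb j ^+ 2 * H * ((a ^+ 2)%:MP * qz j ^+ 2 - (b ^+ 2)%:MP * qz i ^+ 2)).
  rewrite !rmorphXn /=; ring.
transitivity (levi_det i j * (qb j * H * (lam i)%:MP * qz j)
              - qz i * (levi_det i j * r)); last by ring.
rewrite a2 b2 mpolyCN -er /levi_det; ring.
Qed.

(* Here [w] is killed by a derivation that kills [levi_det i j], so that its image
   under the Euler operator is a multiple of [levi_det i j]; hence so is the image
   of [H] under the identity plus the Euler operator. *)
Lemma levi_dvd_sphere i j H E : i != j -> lam i = 0 -> lam j = 0 ->
    (let w := E * levi_det i j - qb j * H in qz j * dz i w = qz i * dz j w) ->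
  mdvd (levi_det i j) H.
Proof.
move=> ne_ij li lj /=; set D := levi_det i j; set w := _ - _ => ew.
have qz_i : qz i = Zb K i by rewrite /qz li mpolyC0; ring.
have qz_j : qz j = Zb K j by rewrite /qz lj mpolyC0; ring.
have qb_i : qb i = Z K i by rewrite /qb li mpolyC0; ring.
have qb_j : qb j = Z K j by rewrite /qb lj mpolyC0; ring.
(* The forms [qz i] and [qz j] are coprime, so by [ew] the two derivatives of w are multiples of
   them with the same factor; the boolean selects the index. *)
have [Y eY] : exists Y, forall b : bool,
    dz (if b then i else j) w = Y * qz (if b then i else j).
  have [||[Y eY]] := @qz_prime _ _ lam j (qz i) (dz j w).
  - by rewrite -ew; exists (dz i w).
  - move/(@mdvd_root _ _ _ _ (zpoint (fun=> 0) (fun l => (l == i)%:R))).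
    rewrite !meval_qz !mulr0 !addr0 eqxx eq_sym (negPf ne_ij) => /(_ erefl)/eqP.
    by rewrite oner_eq0.
  exists Y => -[]; last by rewrite eY mulrC.
  by apply: (mulfI (qz_neq0 lam_ge0 j)); rewrite ew eY; ring.
have euD : euler (lshift n i) (lshift n j) D = D.
  rewrite /D /levi_det qz_i qz_j qb_i qb_j /euler -!/(Z K _) -!dzE.
  rewrite !(dzD, dzM, dz_Z, dz_Zb) !eqxx eq_sym (negPf ne_ij) /=; ring.
have [Y1 eY1] : mdvd D (H + euler (lshift n i) (lshift n j) H).
  rewrite /D levi_detC; apply: (@mdvd_cancel_qb j i j); rewrite 1?[j == i]eq_sym //.
  rewrite levi_detC -/D.
  set eu := euler _ _ in euD *.
  have euw : eu w = D * Y.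
    rewrite /eu /euler -!dzE (eY true) (eY false) -!/(Z K _).
    by rewrite -qb_i -qb_j /D /levi_det; ring.
  have eu_qb : eu (qb j) = qb j.
    rewrite /eu /euler -!dzE qb_j !dz_Z eqxx eq_sym (negPf ne_ij) /=.
    by rewrite /Z; ring.
  exists (E + eu E - Y); rewrite mulrBr -euw.
  have euB p q : eu (p - q) = eu p - eu q by rewrite /eu /euler !mderivB; ring.
  have euM p q : eu (p * q) = eu p * q + p * eu q by apply: eulerM.
  by rewrite euB !euM euD eu_qb; ring.
(* As D has degree 1 in (z_i, z_j), 1 + [euler] maps D Y2 to D (2 Y2 + [euler] Y2) = D Y1, the image
   of H; injectivity then gives H = D Y2. *)
have [Y2 eY2] := add2_euler_surj (lshift n i) (lshift n j) Y1.
exists Y2; apply/eqP; rewrite -subr_eq0; apply/eqP.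
apply: (@add_euler_inj _ _ (lshift n i) (lshift n j)).
set eu := euler _ _ in eY1 eY2 euD *.
have euB p q : eu (p - q) = eu p - eu q by rewrite /eu /euler !mderivB; ring.
have euM p q : eu (p * q) = eu p * q + p * eu q by apply: eulerM.
rewrite euB addrACA -opprD eY1 -eY2 euM euD; ring.
Qed.

End LeviDivisibility.

(** * The equation of the leading term *)

Section LeadingTerm.
Variables (K : numClosedFieldType) (n : nat) (lam : 'I_n -> K).
Hypothesis lam_ge0 : forall i, 0 <= lam i.
Variables (o1 on : 'I_n).
Hypothesis ne1n : o1 != on.
Implicit Types (i j k : 'I_n).

Local Notation poly := {mpoly K[n + n]}.
Local Notation cj := (@mpoly_conj K n).
Local Notation qz := (qz lam).
Local Notation qb := (qb lam).
Local Notation qq := (qq lam).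
Local Notation D := (levi_det lam o1 on).

Implicit Types p e c : poly.

(** These fields annihilate q: they span the (1,0) and (0,1) directions of its leaves where the last
    derivative is nonzero, and [levi] is the Hessian along them. *)
Definition tan_z j p : poly := qz on * dz j p - qz j * dz on p.
Definition tan_b k p : poly := qb on * db k p - qb k * db on p.

Definition levi p j k : poly :=
  qz on * qb on * dz j (db k p) - qz on * qb k * dz j (db on p)
  - qz j * qb on * dz on (db k p) + qz j * qb k * dz on (db on p).

Lemma conj_tan_z j p : cj (tan_z j p) = tan_b j (cj p).
Proof. by rewrite /tan_z rmorphB !rmorphM /= !conj_qz // !conj_dz. Qed.

Lemma conj_tan_b j p : cj (tan_b j p) = tan_z j (cj p).
Proof. by rewrite -[p in LHS]mpoly_conjK -conj_tan_z mpoly_conjK. Qed.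

Lemma conj_levi p j k : cj (levi p j k) = levi (cj p) k j.
Proof.
rewrite /levi rmorphD !rmorphB !rmorphM /= !conj_qz // !conj_qb // !conj_dz !conj_db.
rewrite !(dz_db _ _ (cj p)); ring.
Qed.

Lemma levi_qq j k : j != on -> k != on ->
  levi qq j k = (j == k)%:R * (qz on * qb on) + qz j * qb k.
Proof.
move=> jn kn; rewrite /levi !db_qq // !dz_qb eqxx [k == j]eq_sym (negPf kn).
rewrite [on == j]eq_sym (negPf jn) /=; ring.
Qed.

Lemma levi_qq11 : levi qq o1 o1 = D.
Proof. by rewrite levi_qq // eqxx /levi_det /=; ring. Qed.

Lemma tan_z_D :
  tan_z o1 D = 2 * ((lam o1)%:MP * qz on * qb o1 - (lam on)%:MP * qz o1 * qb on).
Proof.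
rewrite /tan_z /levi_det !(dz_qz, dz_qb, dzM, dzD) !eqxx eq_sym (negPf ne1n) /=.
ring.
Qed.

Section Solve.
Variables (e : poly).
Hypothesis conj_e : cj e = e.
Hypothesis proportional : forall j k, j != on -> k != on -> k != o1 ->
  levi e j k * D = levi e o1 o1 * levi qq j k.
Hypothesis tangential :
  let w := db on e * D - qb on * levi e o1 o1 in w * tan_z o1 D = D * tan_z o1 w.
Hypothesis lam_half : exists i, lam i != 2^-1.

Lemma levi_det_dvd : mdvd D (levi e o1 o1).
Proof.
have [j /andP[jn j1]|small] := pickP (fun j => (j != on) && (j != o1)).
  (* A third index j makes [levi qq o1 j] the product of the linear forms [qz o1] and [qb j]. *)
  apply: (mdvd_cancel_qz lam_ge0 ne1n); apply: (mdvd_cancel_qb lam_ge0 ne1n jn).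
  have := proportional ne1n jn j1; rewrite levi_qq // [o1 == j]eq_sym (negPf j1).
  by move=> E; exists (levi e o1 j); rewrite [RHS]mulrC E /=; ring.
have half : (lam o1 != 2^-1) || (lam on != 2^-1).
  have [i li] := lam_half; have := small i; apply: contraFT; rewrite negb_or.
  rewrite !negbK => /andP[/eqP l1 /eqP ln].
  by apply/andP; split; apply: contra_neq li => ->.
have tg := tangential; move: tg => /=; set w := _ - _ => tg.
have [nz|] := boolP ((lam o1 != 0) || (lam on != 0)).
  apply: (levi_dvd_generic lam_ge0 ne1n nz half).
  exists (2^-1%:MP * (db on e * tan_z o1 D - tan_z o1 w)).
  transitivity (2^-1%:MP * (db on e * D * tan_z o1 D - D * tan_z o1 w)); last by ring.
  have u2 : 2^-1%:MP * 2 = 1 :> poly.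
    by rewrite two_mpolyC -mpolyCM mulVf ?pnatr_eq0 // mpolyC1.
  by rewrite -[LHS]mul1r -u2 -tg /w tan_z_D; ring.
rewrite negb_or !negbK => /andP[/eqP l1 /eqP ln].
(* Here [tan_z o1] annihilates D, hence w as well. *)
apply: (levi_dvd_sphere lam_ge0 (E := db on e) ne1n l1 ln); rewrite -/w.
apply/eqP; rewrite -subr_eq0; apply/eqP; rewrite -/(tan_z o1 w).
have D0 : D != 0.
  apply/eqP => D0; have := levi_det_eval_neq0 lam_ge0 ne1n.
  by rewrite D0 meval0 eqxx.
apply: (mulfI D0); rewrite -tg tan_z_D l1 ln mpolyC0; ring.
Qed.


Lemma tan_zM j p q : tan_z j (p * q) = tan_z j p * q + p * tan_z j q.
Proof. rewrite /tan_z !dzM; ring. Qed.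
Lemma tan_bM k p q : tan_b k (p * q) = tan_b k p * q + p * tan_b k q.
Proof. rewrite /tan_b !dbM; ring. Qed.

(** Both fields are tangent to the leaves of q, so their bracket is a combination of them; the
    factor [qb on] clears the denominator. *)
Lemma tan_b_commutator k p : k != o1 -> k != on ->
  qb on * (tan_b o1 (tan_b k p) - tan_b k (tan_b o1 p))
  = - (2 * (lam on)%:MP * (qb o1 * tan_b k p - qb k * tan_b o1 p)).
Proof.
move=> k1 kn; rewrite /tan_b !(db_qb, dbM, dbB).
rewrite !(db_db k o1) !(db_db on _ p) !eqxx [on == o1]eq_sym [on == k]eq_sym.
rewrite [o1 == k]eq_sym (negPf ne1n) (negPf k1) (negPf kn) /=; ring.
Qed.

(* The functions [dz j e - c * qz j] are first shown to be killed by [tan_b o1];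
   since [tan_b o1] and [tan_b k] commute up to a combination of themselves, they
   are then killed by every [tan_b k]. *)
Lemma leading_quotient : exists c (eps : 'I_n -> poly),
  [/\ cj c = c, levi e o1 o1 = D * c
    & forall j k, db k (dz j e - c * qz j) = eps j * qb k].
Proof.
have [c ec] := levi_det_dvd.
have D0 : D != 0.
  apply/eqP => D0; have := levi_det_eval_neq0 lam_ge0 ne1n.
  by rewrite D0 meval0 eqxx.
have cc : cj c = c.
  apply: (mulfI D0); rewrite -ec -[in RHS]conj_e -conj_levi ec rmorphM /=.
  by rewrite levi_det_conj.
(* The case k = o1, not covered by the proportionality, follows by Hermitian symmetry. *)
have leviE j k : j != on -> k != on -> levi e j k = c * levi qq j k.
  have gen j' k' : j' != on -> k' != on -> k' != o1 ->
      levi e j' k' = c * levi qq j' k'.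
    move=> jn kn k1; apply: (mulIf D0); rewrite proportional // ec; ring.
  move=> jn kn; have [->|k1] := eqVneq k o1; last exact: gen.
  have [->|j1] := eqVneq j o1; first by rewrite ec levi_qq11 mulrC.
  rewrite -[e]conj_e -conj_levi gen // rmorphM /= cc conj_levi.
  by rewrite conj_qq.
pose ej j := dz j e - c * qz j.
have rel j k : j != on -> k != on ->
    qz on * tan_b k (ej j) = qz j * tan_b k (ej on).
  move=> jn kn; apply/eqP; rewrite -subr_eq0; apply/eqP.
  transitivity (levi e j k - c * levi qq j k); last by rewrite leviE ?subrr.
  rewrite levi_qq // /levi /tan_b /ej !(db_qz, dbM, dbB) !dz_db !eqxx.
  by rewrite [on == k]eq_sym (negPf jn) (negPf kn) /=; ring.
(* Since [levi e o1 o1] is D c, w is D times the conjugate of [ej on], and the Wronskian condition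
   says that the quotient w / D is constant along [tan_z o1]. *)
have s1n : tan_b o1 (ej on) = 0.
  apply: (can_inj (@mpoly_conjK K n)); rewrite rmorph0 conj_tan_b.
  have -> : cj (ej on) = db on e - c * qb on.
    by rewrite rmorphB rmorphM /= conj_dz conj_e cc conj_qz.
  have := tangential; set y := db on e - c * qb on.
  have -> : db on e * D - qb on * levi e o1 o1 = D * y by rewrite ec /y; ring.
  rewrite /= tan_zM => ty; apply: (mulfI D0); apply: (mulfI D0).
  rewrite !mulr0; apply/eqP; rewrite -subr_eq0 subr0; apply/eqP.
  transitivity (D * (tan_z o1 D * y + D * tan_z o1 y) - D * y * tan_z o1 D).
    by ring.
  by rewrite ty subrr.
have s_1 j : j != on -> tan_b o1 (ej j) = 0.
  move=> jn; apply: (mulfI (qz_neq0 lam_ge0 on)).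
  by rewrite rel // s1n !mulr0.
have s_n k : k != on -> tan_b k (ej on) = 0.
  move=> kn; have [->//|k1] := eqVneq k o1.
  have com j : tan_b o1 (ej j) = 0 -> qb on * tan_b o1 (tan_b k (ej j))
      = - (2 * (lam on)%:MP * (qb o1 * tan_b k (ej j))).
    move=> s0; have := tan_b_commutator (ej j) k1 kn.
    rewrite s0 mulr0 subr0 => <-; rewrite /tan_b.
    by rewrite -[0]/(0 : poly) -mpolyC0 !db_C !mulr0 subrr subr0.
  have r1 := rel _ _ ne1n kn.
  have := congr1 (tan_b o1) r1; rewrite !tan_bM => r2.
  have tqn : tan_b o1 (qz on) = - qb o1.
    by rewrite /tan_b !db_qz eqxx eq_sym (negPf ne1n) /=; ring.
  have tq1 : tan_b o1 (qz o1) = qb on.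
    by rewrite /tan_b !db_qz eqxx (negPf ne1n) /=; ring.
  rewrite tqn tq1 in r2.
  set s1 := tan_b k (ej o1) in r1 r2; set sn := tan_b k (ej on) in r1 r2 *.
  have c1 := com o1 (s_1 _ ne1n); have cn := com on s1n.
  rewrite -/s1 in c1; rewrite -/sn in cn.
  apply: (mulfI D0); apply: (mulfI (qb_neq0 lam_ge0 on)).
  rewrite !mulr0.
  set t1 := tan_b o1 s1 in c1 r2; set tn := tan_b o1 sn in cn r2.
  (* By the commutator relations and [r1], the terms in [t1] and [tn] cancel, leaving
     [qb o1 * s1 + qb on * sn = 0]; together with [r1] this is a linear system of determinant D. *)
  transitivity (qb on * qz on *
        ((qb on * sn + qz o1 * tn) - (- qb o1 * s1 + qz on * t1))
      + qz on * qz on * (qb on * t1 - - (2 * (lam on)%:MP * (qb o1 * s1)))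
      - qz on * qz o1 * (qb on * tn - - (2 * (lam on)%:MP * (qb o1 * sn)))
      - (qb on * qb o1 + 2 * (lam on)%:MP * qb o1 * qz on)
        * (qz on * s1 - qz o1 * sn)).
    by rewrite /levi_det; ring.
  by rewrite r2 c1 cn r1 !subrr !mulr0 !subr0 addr0.
have qbn0 := qb_neq0 lam_ge0 on.
have s_j j k : qb on * db k (ej j) = qb k * db on (ej j).
  have [->//|kn] := eqVneq k on.
  apply/eqP; rewrite -subr_eq0; apply/eqP; rewrite -/(tan_b k (ej j)).
  have [->|jn] := eqVneq j on; first exact: s_n.
  by apply: (mulfI (qz_neq0 lam_ge0 on)); rewrite rel // s_n // !mulr0.
have /fin_all_exists[eps heps] : forall j, exists y, forall k, db k (ej j) = y * qb k.
  move=> j; apply: (@qb_ratio _ _ _ lam_ge0 _ _ _ ne1n) => k l.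
  by apply: (mulfI qbn0); rewrite !mulrA !s_j; ring.
by exists c, eps.
Qed.

End Solve.
End LeadingTerm.

(** * Primitives in w: solving e = 2 Re F(z, q) *)

Lemma msize_mderiv_le (R : nzRingType) k (p : {mpoly R[k]}) (i : 'I_k) :
  (msize p^`M(i) <= msize p)%N.
Proof.
rewrite [X in (X <= _)%N]msizeE; apply/bigmax_leqP_seq => m m_in _.
have mU_in : (m + U_(i))%MM \in msupp p.
  move: m_in; rewrite !mcoeff_msupp mcoeff_mderiv.
  by apply: contra_neq => ->; rewrite mul0rn.
by apply: leq_ltn_trans (msize_mdeg_lt mU_in); rewrite mdegD leq_addr.
Qed.

Lemma mpoly_antideriv (K : numFieldType) k (i : 'I_k) (p : {mpoly K[k]}) :
  exists q, q^`M(i) = p.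
Proof.
elim/mpolyind: p => [|c m p _ _ [q eq]]; first by exists 0; rewrite mderiv0.
exists ((c / (m i).+1%:R) *: 'X_[m + U_(i)] + q).
rewrite mderivD eq mderivZ mderivX mnmDE mnm1E eqxx addn1 addmK scalerA.
by rewrite divfK // pnatr_eq0.
Qed.

Section FormalSolution.
Variables (K : numClosedFieldType) (n : nat) (lam : 'I_n -> K).
Hypothesis lam_ge0 : forall i, 0 <= lam i.
Variables (o1 on : 'I_n).
Hypothesis ne1n : o1 != on.
Implicit Types (i j k : 'I_n).

Local Notation poly := {mpoly K[n + n]}.
Local Notation cj := (@mpoly_conj K n).
Local Notation qz := (qz lam).
Local Notation qb := (qb lam).
Local Notation qq := (qq lam).
Local Notation w_ := (rshift n (ord0 : 'I_1)).

Implicit Types (p E c : poly) (F : {mpoly K[n + 1]}).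

Definition at_q_var (l : 'I_(n + 1)) : poly :=
  match split l with inl j => Z K j | inr _ => qq end.
(** F(z, q), the restriction of F to the model w = q. *)
Definition at_q F : poly := mmap (@mpolyC (n + n) K) at_q_var F.

HB.instance Definition _ := GRing.RMorphism.copy at_q
  (mmap (@mpolyC (n + n) K) at_q_var).

Lemma at_q_varZ j : at_q_var (lshift 1 j) = Z K j.
Proof.
rewrite /at_q_var; case: split_ordP => l /eqP; rewrite eq_shift // => /eqP ->//.
Qed.
Lemma at_q_varW : at_q_var w_ = qq.
Proof.
by rewrite /at_q_var; case: split_ordP => l /eqP; rewrite eq_shift.
Qed.

Lemma dz_at_q j F :
  dz j (at_q F) = at_q F^`M(lshift 1 j) + at_q F^`M(w_) * qz j.
Proof.
rewrite (deriv_mmap _ (dzD j) (dzM j) (dz_C j)) big_split_ord big_ord1 /=.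
rewrite at_q_varW dz_qq (bigD1 j) //= at_q_varZ dz_Z eqxx mulr1 big1 ?addr0 //.
by move=> i /negPf ne_ij; rewrite at_q_varZ dz_Z ne_ij mulr0.
Qed.

Lemma db_at_q j F : db j (at_q F) = at_q F^`M(w_) * qb j.
Proof.
rewrite (deriv_mmap _ (dbD j) (dbM j) (db_C j)) big_split_ord big_ord1 /=.
rewrite at_q_varW db_qq // big1 ?add0r // => i _.
by rewrite at_q_varZ db_Z mulr0.
Qed.

(** The matrix with entries [x j * qb k] has rank at most one and is Hermitian, so its columns, like
    its rows, follow the gradient of q, with a real factor. *)
Lemma hermitian_ratio (x : 'I_n -> poly) :
    (forall j k, x j * qb k = cj (x k) * qz j) ->
  exists2 y, cj y = y & forall j, x j = y * qz j.
Proof.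
move=> ex; have [|y ey] := @qz_ratio _ _ _ lam_ge0 x _ _ ne1n.
  move=> k l; apply: (mulIf (qb_neq0 lam_ge0 o1)).
  transitivity (x k * qb o1 * qz l); first by ring.
  rewrite ex; transitivity (cj (x o1) * qz l * qz k); first by ring.
  by rewrite -ex; ring.
exists y => //; apply: (mulIf (qz_neq0 lam_ge0 o1)).
apply: (mulIf (qb_neq0 lam_ge0 o1)).
have := ex o1 o1; rewrite ey rmorphM /= conj_qz // => e1.
by rewrite e1; ring.
Qed.

(** Only monomials in z alone or in its conjugate alone survive, so E = F + conj G; averaging with
    the conjugate replaces both F and G by (F + G) / 2. *)
Lemma pluriharmonic_split E : cj E = E -> (forall j k, db k (dz j E) = 0) ->
  exists F, E = at_q F + cj (at_q F).
Proof.
move=> realE phE.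
have [F [G eE]] : exists F G, E = at_q F + cj (at_q G); last first.
  exists (2^-1%:MP * (F + G)).
  have u2 : 2^-1%:MP * 2 = 1 :> poly.
    by rewrite two_mpolyC -mpolyCM mulVf ?pnatr_eq0 // mpolyC1.
  have qC : at_q 2^-1%:MP = 2^-1%:MP by exact: mmapC.
  rewrite !rmorphM !rmorphD /= qC mpoly_conjC.
  have -> : (2^-1)^* = 2^-1 :> K by rewrite fmorphV rmorph_nat.
  have := realE; rewrite {1}eE rmorphD /= mpoly_conjK => e2.
  transitivity (2^-1%:MP * (E + E)).
    by rewrite -[LHS]mul1r -u2; ring.
  by rewrite -{1}e2 {1}eE; ring.
have supp m : m \in msupp E ->
    [forall k, m (rshift n k) == 0%N] || [forall j, m (lshift n j) == 0%N].
  rewrite mcoeff_msupp; apply: contraNT; rewrite negb_or !negb_forall.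
  case/andP=> /existsP[k mk] /existsP[j mj].
  have := congr1 (mcoeff (m - U_(lshift n j) - U_(rshift n k))%MM) (phE j k).
  rewrite dbE dzE !mcoeff_mderiv mcoeff0 submK; last first.
    by rewrite lep1mP mnmBE mnm1E eq_lrshift subn0.
  rewrite submK ?lep1mP // => /eqP; rewrite !mulrn_eq0 /=.
  by [].
rewrite [E]mpolyE big_seq.
elim/big_ind: _ => [|p q [F [G ->]] [F' [G' ->]]|m /supp].
- by exists 0, 0; rewrite !rmorph0 addr0.
- by exists (F + F'), (G + G'); rewrite !rmorphD /=; ring.
case/orP=> /forallP m0.
- exists (E@_m *: \prod_(j < n) 'X_(lshift 1 j) ^+ m (lshift n j)), 0.
  rewrite !rmorph0 addr0 -mul_mpolyC -mul_mpolyC rmorphM /= [at_q _%:MP]mmapC.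
  congr (_ * _); rewrite mpolyXE_id big_split_ord /= [X in _ * X]big1 ?mulr1.
    rewrite rmorph_prod; apply: eq_bigr => j _.
    by rewrite rmorphXn /= [at_q _]mmapX mmap1U at_q_varZ.
  by move=> k _; rewrite (eqP (m0 k)) expr0.
exists 0, ((E@_m)^* *: \prod_(j < n) 'X_(lshift 1 j) ^+ m (rshift n j)).
rewrite rmorph0 add0r -mul_mpolyC -mul_mpolyC !rmorphM /= [at_q _%:MP]mmapC.
rewrite mpoly_conjC conjCK; congr (_ * _).
rewrite mpolyXE_id big_split_ord /= [X in X * _]big1 ?mul1r.
  rewrite !rmorph_prod; apply: eq_bigr => j _.
  by rewrite !rmorphXn /= [at_q _]mmapX mmap1U at_q_varZ conj_Z.
by move=> k _; rewrite (eqP (m0 k)) expr0.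
Qed.

Lemma msize_qz_gt1 j : (1 < msize (qz j))%N.
Proof.
suff m_in : U_(rshift n j)%MM \in msupp (qz j).
  by rewrite -(mdeg1 (rshift n j)); apply: msize_mdeg_lt m_in.
rewrite mcoeff_msupp /qz mcoeffD mcoeffX eqxx two_mpolyC -mpolyCM mcoeffCM.
by rewrite mcoeffX eq_mnm1 eq_lrshift mulr0 addr0 oner_eq0.
Qed.
Lemma msize_qb_gt1 j : (1 < msize (qb j))%N.
Proof.
suff m_in : U_(lshift n j)%MM \in msupp (qb j).
  by rewrite -(mdeg1 (lshift n j)); apply: msize_mdeg_lt m_in.
rewrite mcoeff_msupp /qb mcoeffD mcoeffX eqxx two_mpolyC -mpolyCM mcoeffCM.
by rewrite mcoeffX eq_mnm1 eq_rlshift mulr0 addr0 oner_eq0.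
Qed.

Lemma msize_qz_le2 j : (msize (qz j) <= 2)%N.
Proof.
apply: leq_trans (msizeD_le _ _) _; rewrite geq_max msizeX mdeg1 /=.
rewrite two_mpolyC -mpolyCM mul_mpolyC; apply: leq_trans (msizeZ_le _ _) _.
by rewrite msizeX mdeg1.
Qed.

Lemma msize_mul_lin p l d : (1 < msize l)%N ->
  (msize (p * l) <= d.+1)%N -> (msize p <= d)%N.
Proof.
have [->|p0] := eqVneq p 0; first by rewrite msize0.
move=> l1; have l0 : l != 0 by rewrite -msize_poly_eq0 -lt0n (ltnW l1).
rewrite msizeM // => h; rewrite -ltnS; apply: leq_trans h.
by case: (msize l) l1 => [|[|s]] //= _; rewrite addnS /= addnS ltnS leq_addr.
Qed.

Lemma msizeB_max p q d :
  (msize p <= d -> msize q <= d -> msize (p - q) <= d)%N.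
Proof.
move=> hp hq; apply: leq_trans (msizeD_le _ _) _.
by rewrite geq_max hp msizeN hq.
Qed.

(** A form y dq' dq'', with dq' and dq'' the (1,0) and (0,1) parts of dq, is assumed closed under
    the conjugate differential. Eliminating the derivatives of y from two of its components leaves y
    D = 0. *)
Lemma levi_flat_zero (y : poly) :
    (forall j k l, db l (y * qz j * qb k) = db k (y * qz j * qb l)) -> y = 0.
Proof.
move=> ey; have D0 : levi_det lam o1 on != 0.
  apply/eqP => D0; have := levi_det_eval_neq0 lam_ge0 ne1n.
  by rewrite D0 meval0 eqxx.
apply: (mulfI D0); rewrite mulr0.
have := ey o1 on o1; have := ey on on o1.
rewrite !(db_qz, db_qb, dbM) !eqxx [on == o1]eq_sym (negPf ne1n) /=.
rewrite !(mulr0, addr0, mulr1) => e1 e2.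
transitivity (qz on * ((db o1 y * qz o1 + y) * qb on)
            - qz o1 * (db o1 y * qz on * qb on) + qz o1 * qb o1 * y).
  by rewrite /levi_det; ring.
rewrite e1 e2; ring.
Qed.

(* The hypotheses pass from [E] to [c], in lower degree and with
   [dz j c = c' * qz j + eps j]. If [c = 2 Re h(z, q)] and [H] is a primitive of [h] in [w], then
   [E - 2 Re H(z, q)] is pluriharmonic. *)
Lemma formal_solution d E c (eps : 'I_n -> poly) :
    cj E = E -> cj c = c ->
    (forall j k, db k (dz j E - c * qz j) = eps j * qb k) ->
    (msize E <= d)%N -> (msize c <= d.-1)%N ->
  exists F, E = at_q F + cj (at_q F).
Proof.
elim: d E c eps => [|d IHd] E c eps realE realc eqE szE szc.
  exists 0; rewrite !rmorph0 addr0; apply/eqP.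
  by rewrite -msize_poly_eq0 -leqn0.
have hess j k : db k (dz j E) = db k c * qz j + c * (j == k)%:R + eps j * qb k.
  by rewrite -eqE dbB dbM db_qz; ring.
(* The Hessian of E is Hermitian and so is its term in c alone; the other two terms provide the
   hypothesis of [hermitian_ratio]. *)
have [c' realc' ec'] : exists2 y, cj y = y &
    forall j, dz j c - eps j = y * qz j.
  apply: hermitian_ratio => j k.
  rewrite /= rmorphB /= conj_dz realc.
  have := congr1 cj (hess k j); rewrite conj_db conj_dz realE dz_db hess.
  rewrite !rmorphD !rmorphM rmorph_nat /= conj_qz // conj_qb // conj_db realc.
  rewrite [k == j]eq_sym => e; apply/eqP; rewrite -subr_eq0; apply/eqP.
  transitivity (dz j c * qb k + c * (j == k)%:R + cj (eps k) * qz j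
    - (dz j c * qb k + c * (j == k)%:R + cj (eps k) * qz j)); last exact: subrr.
  by rewrite -{2}e; ring.
(* Conjugate derivatives commute, which makes the conjugate gradient of [eps j] parallel to that of
   q. *)
have eps_ratio j : exists y, forall k, db k (eps j) = y * qb k.
  apply: (qb_ratio lam_ge0 ne1n) => k l.
  have := db_db k l (dz j E - c * qz j); rewrite !eqE !dbM !db_qb.
  have [->//|_] := eqVneq k l.
  by rewrite !mulr0 !addr0.
have /fin_all_exists[eps' heps'] := eps_ratio.
have [h eh] : exists F, c = at_q F + cj (at_q F).
  apply: (IHd c c' eps') => //.
    by move=> j k; rewrite -ec' opprB addrCA subrr addr0 heps'.
  (* The degree drops at each division by a linear form; of derivatives it is only used that they do
     not raise it. *)
  apply: (msize_mul_lin (msize_qz_gt1 on)); rewrite -ec'.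
  apply: leq_trans (leqSpred d); apply: msizeB_max.
    by rewrite dzE; apply: leq_trans szc; apply: msize_mderiv_le.
  apply: (msize_mul_lin (msize_qb_gt1 on)); rewrite -eqE dbE.
  apply: leq_trans (msize_mderiv_le _ _) _; apply: msizeB_max.
    by rewrite dzE; apply: leq_trans szE; apply: msize_mderiv_le.
  have [->|c0] := eqVneq c 0; first by rewrite mul0r msize0.
  rewrite msizeM ?qz_neq0 // -subn1.
  rewrite (leq_trans (leq_sub2r 1 (leq_add szc (msize_qz_le2 on)))) //.
  by rewrite addn2.
have [H eH] := mpoly_antideriv w_ h.
set E1 := E - (at_q H + cj (at_q H)).
have realE1 : cj E1 = E1.
  by rewrite /E1 rmorphB rmorphD /= mpoly_conjK realE; congr (_ - _); apply: addrC.
pose x j := eps j - at_q (H^`M(lshift 1 j))^`M(w_).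
have hessE1 j k : db k (dz j E1) = x j * qb k.
  rewrite /E1 dzB dzD dz_at_q -conj_db db_at_q eH rmorphM /= conj_qb //.
  rewrite [X in db k X](_ : _ = dz j E - c * qz j - at_q H^`M(lshift 1 j)).
    by rewrite dbB eqE db_at_q /x; ring.
  by rewrite eh; ring.
have [y _ ey] : exists2 y, cj y = y & forall j, x j = y * qz j.
  apply: hermitian_ratio => j k.
  rewrite -hessE1 -[in LHS]realE1 -conj_qb // -rmorphM /= -hessE1 //.
  by rewrite conj_db conj_dz dz_db.
have y0 : y = 0.
  by apply: levi_flat_zero => j k l; rewrite -!ey -!hessE1 db_db.
have [|F eF] := pluriharmonic_split realE1.
  by move=> j k; rewrite hessE1 ey y0 !mul0r.
exists (H + F); rewrite !rmorphD /=.
by rewrite addrACA -eF /E1 addrC subrK.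
Qed.

End FormalSolution.

(** * The grading by weight *)

(** The weight 2 of w is the degree of q, so that [at_q] is graded; it also fits the growth
    condition in |z|^2 + |w|. *)
Definition zw_weight n (m : 'X_{1..n + 1}) : nat :=
  (\sum_(j < n) m (lshift 1 j) + 2 * m (rshift n ord0))%N.

Section LeadingFlat.
Variables (K : numClosedFieldType) (n : nat) (lam : 'I_n -> K).
Hypothesis lam_ge0 : forall i, 0 <= lam i.
Variables (o1 on : 'I_n).
Hypothesis ne1n : o1 != on.

Local Notation poly := {mpoly K[n + n]}.
Local Notation cj := (@mpoly_conj K n).
Local Notation at_q := (at_q lam).
Local Notation D := (levi_det lam o1 on).
Implicit Types (e : poly) (F : {mpoly K[n + 1]}).

Lemma qq_homog : qq lam \is 2.-homog.
Proof.
apply: rpred_sum => i _; apply: rpredD.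
  by apply: (@dhomogM _ _ _ 1 _ 1); rewrite dhomogX /= mdeg1.
rewrite mul_mpolyC rpredZ // rpredD // expr2.
  by apply: (@dhomogM _ _ _ 1 _ 1); rewrite dhomogX /= mdeg1.
by apply: (@dhomogM _ _ _ 1 _ 1); rewrite dhomogX /= mdeg1.
Qed.

Lemma at_qX_homog m : at_q 'X_[m] \is (zw_weight m).-homog.
Proof.
rewrite /at_q mmapX /mmap1 big_split_ord big_ord1 /=.
apply: dhomogM; last by rewrite at_q_varW; apply: dhomogMn; apply: qq_homog.
elim/big_rec2: _ => [|j d p _ hp]; first exact: dhomog1.
apply: dhomogM hp; rewrite at_q_varZ.
have hZ : Z K j \is 1.-homog by rewrite dhomogX /= mdeg1.
by have := dhomogMn (m (lshift 1 j)) hZ; rewrite mul1n.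
Qed.

Lemma at_q_homog d F :
  {in msupp F, forall m, zw_weight m = d} -> at_q F \is d.-homog.
Proof.
move=> wF; rewrite [F]mpolyE rmorph_sum /= big_seq; apply: rpred_sum => m mF.
rewrite -mul_mpolyC rmorphM /= [at_q _%:MP]mmapC mul_mpolyC rpredZ //.
by rewrite -(wF m mF) at_qX_homog.
Qed.

Lemma at_q_part d F : exists2 Fd, {in msupp Fd, forall m, zw_weight m = d}
  & forall m, mdeg m = d -> (at_q F)@_m = (at_q Fd)@_m.
Proof.
elim/mpolyind: F => [|c l F _ _ [Fd wFd eFd]].
  by exists 0 => // m; rewrite msupp0.
have [wl|wl] := eqVneq (zw_weight l) d.
  exists (c *: 'X_[l] + Fd) => [m /msuppD_le|m md].
    rewrite mem_cat => /orP[/msuppZ_le|]; last exact: wFd.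
    by rewrite msuppX inE => /eqP->.
  by rewrite !rmorphD !mcoeffD eFd.
exists Fd => // m md; rewrite rmorphD mcoeffD eFd // -mul_mpolyC rmorphM /=.
rewrite [at_q _%:MP]mmapC mcoeffCM (dhomog_nemf_coeff (at_qX_homog l)).
  by rewrite mulr0 add0r.
by rewrite /= md eq_sym.
Qed.

Lemma mdeg_swap (m : 'X_{1..n + n}) : mdeg (mnm_swap m) = mdeg m.
Proof.
rewrite !mdegE (reindex_inj (inv_inj (@swap_barK n))) /=.
by apply: eq_bigr => i _; rewrite mnmE swap_barK.
Qed.

Lemma leading_flat d e : e \is d.-homog -> cj e = e ->
    (forall j k, j != on -> k != on -> k != o1 ->
      levi lam on e j k * D = levi lam on e o1 o1 * levi lam on (qq lam) j k) ->
    (let w := db on e * D - qb lam on * levi lam on e o1 o1 in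
      w * tan_z lam on o1 D = D * tan_z lam on o1 w) ->
    (exists i, lam i != 2^-1) ->
  exists2 F, {in msupp F, forall m, zw_weight m = d}
    & e = at_q F + cj (at_q F).
Proof.
move=> he realE prop tang half.
have [c [eps [realc _ eqE]]] := leading_quotient lam_ge0 ne1n realE prop tang half.
(* The size bound only feeds the induction and may be taken large; homogeneity is restored
   afterwards by [at_q_part]. *)
have [||F eF] := formal_solution lam_ge0 ne1n
    (d := (maxn (msize e) (msize c)).+1) realE realc eqE.
  by rewrite leqW // leq_maxl.
  by rewrite leq_maxr.
have [Fd wFd eFd] := at_q_part d F; exists Fd => //.
apply/mpolyP => m; have [md|md] := eqVneq (mdeg m) d.
  by rewrite eF !mcoeffD !mcoeff_conj !eFd ?mdeg_swap.
have hFd := at_q_homog wFd.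
rewrite mcoeffD mcoeff_conj (dhomog_nemf_coeff he) //.
by rewrite !(dhomog_nemf_coeff hFd) /= ?mdeg_swap // rmorph0 addr0.
Qed.

End LeadingFlat.

(** * Leading terms of formal series *)

Section FpsCalculus.
Variables (k : nat) (K : comNzRingType).
Implicit Types (f g : fps k K) (P Q : {mpoly K[k]}) (i : 'I_k).

Lemma fps_derivD i : {morph @fps_deriv k K i : f g / f + g}.
Proof. by move=> f g; apply: fpsP => m /=; rewrite mulrnDl. Qed.

Lemma fps_derivZ i c f : fps_deriv i (c *: f) = c *: fps_deriv i f.
Proof. by apply: fpsP => m /=; rewrite mulrnAr. Qed.

Lemma fps_coefM d f g m : (mdeg m < d)%N ->
  (f * g) m = (fps_trunc d f * fps_trunc d g)@_m.
Proof. exact: fps_mulE. Qed.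

Lemma fps_derivM i f g :
  fps_deriv i (f * g) = fps_deriv i f * g + f * fps_deriv i g.
Proof.
apply: fpsP => m; set d := (mdeg m).+2.
rewrite -[LHS]/((f * g) (m + U_(i))%MM *+ (m i).+1).
have truncE h l : (mdeg l <= mdeg m)%N -> (fps_trunc d h)@_l = h l.
  by move=> le_lm; rewrite fps_truncE // ltnS leqW.
have derivE h l : (mdeg l <= mdeg m)%N ->
    (fps_trunc d h)^`M(i)@_l = fps_deriv i h l.
  by move=> le_lm; rewrite mcoeff_deriv fps_truncE // mdegD mdeg1 addn1 !ltnS.
rewrite (@fps_coefM d) ?mdegD ?mdeg1 ?addn1 // -mcoeff_deriv mderivM mcoeffD.
rewrite !mcoeffM; congr (_ + _); apply: eq_bigr => -[l r] /= _.
  by rewrite derivE ?truncE // -ltnS bmdeg.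
by rewrite derivE ?truncE // -ltnS bmdeg.
Qed.

Lemma fps_derivC i c : fps_deriv i (c%:A : fps k K) = 0.
Proof.
apply: fpsP => m /=; rewrite mnmD_eq0 mnm1_eq0 andbF mulr0 mul0rn //.
Qed.

Lemma fps_deriv_comm i j f :
  fps_deriv i (fps_deriv j f) = fps_deriv j (fps_deriv i f).
Proof.
apply: fpsP => m /=; rewrite -!mulrnA !mnmDE !mnm1E -!addmA.
rewrite [(U_(i) + U_(j))%MM]addmC [j == i]eq_sym.
by have [->//|_] := eqVneq i j; rewrite !addn0 mulnC.
Qed.

(** The polynomial P may be 0, and then f has order above a; so leading parts add and multiply
    without case distinctions. *)
Definition leading (a : nat) f P : Prop :=
  P \is (a).-homog /\ forall m, (mdeg m <= a)%N -> f m = P@_m.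

Lemma homog_coef a P m : P \is (a).-homog -> mdeg m != a -> P@_m = 0.
Proof. exact: dhomog_nemf_coeff. Qed.

Lemma leading_unique a f P Q : leading a f P -> leading a f Q -> P = Q.
Proof.
move=> [hP fP] [hQ fQ]; apply/mpolyP => m.
have [md|md] := eqVneq (mdeg m) a; first by rewrite -fP -?fQ ?md.
by rewrite (homog_coef hP) // (homog_coef hQ).
Qed.

Lemma leading_eq0 a f P m : leading a f P -> (mdeg m < a)%N -> f m = 0.
Proof.
by case=> hP fP lt; rewrite fP ?(ltnW lt) // (homog_coef hP) // ltn_eqF.
Qed.

Lemma leading_lt a b f P : leading a f P -> (b < a)%N -> leading b f 0.
Proof.
move=> lP lt_ba; split=> [|m le_mb]; first exact: dhomog0.
by rewrite mcoeff0 (leading_eq0 lP) // (leq_ltn_trans le_mb).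
Qed.

Lemma leading_trunc a f : fps_order_ge a f -> leading a f (fps_trunc a.+1 f).
Proof.
move=> ordf; split=> [|m le_ma]; last by rewrite fps_truncE.
apply/dhomogP => m; rewrite mcoeff_msupp /=.
have [lt_ma|] := ltnP (mdeg m) a.
  by rewrite fps_truncE ?ordf ?eqxx // ltnW.
rewrite leq_eqVlt => /orP[/eqP//|lt_am].
rewrite -mcoeff_msupp => /msupp_sum_le /flattenP[/= s /mapP[/= x]].
rewrite mem_filter => _ -> /msuppZ_le; rewrite msuppX inE => /eqP em.
by move: lt_am; rewrite em ltnNge -ltnS bmdeg.
Qed.

Lemma leading0 a : leading a 0 0.
Proof. by split=> [|m _]; rewrite ?dhomog0 // mcoeff0. Qed.

Lemma leading_order a f : leading a f 0 -> fps_order_ge a.+1 f.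
Proof. by case=> _ f0 m; rewrite ltnS => /f0 ->; rewrite mcoeff0. Qed.

Lemma leadingD a f g P Q :
  leading a f P -> leading a g Q -> leading a (f + g) (P + Q).
Proof.
move=> [hP fP] [hQ gQ]; split=> [|m le_ma]; first exact: dhomogD.
by rewrite mcoeffD -fP // -gQ.
Qed.

Lemma leadingZ a c f P : leading a f P -> leading a (c *: f) (c *: P).
Proof.
move=> [hP fP]; split=> [|m le_ma]; first exact: dhomogZ.
by rewrite mcoeffZ -fP.
Qed.

Lemma leadingN a f P : leading a f P -> leading a (- f) (- P).
Proof. by rewrite -!scaleN1r; apply: leadingZ. Qed.

Lemma leadingB a f g P Q :
  leading a f P -> leading a g Q -> leading a (f - g) (P - Q).
Proof. by move=> lf lg; apply: leadingD => //; apply: leadingN. Qed.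

Lemma leadingM a b f g P Q :
  leading a f P -> leading b g Q -> leading (a + b) (f * g) (P * Q).
Proof.
move=> lP lQ; have [[hP fP] [hQ gQ]] := (lP, lQ).
split=> [|m le_m]; first exact: dhomogM.
rewrite mcoeffM; apply: eq_bigr => -[l r] /= /eqP em.
have le_lr : (mdeg l + mdeg r <= a + b)%N by rewrite -mdegD -em.
have [le_la|lt_al] := leqP (mdeg l) a; last first.
  have lt_rb : (mdeg r < b)%N.
    by rewrite -(ltn_add2l a) (leq_trans _ le_lr) // ltn_add2r.
  by rewrite (leading_eq0 lQ) // (homog_coef hQ) ?mulr0 ?ltn_eqF.
have [le_rb|lt_br] := leqP (mdeg r) b; first by rewrite fP ?gQ.
have lt_la : (mdeg l < a)%N.
  by rewrite -(ltn_add2r b) (leq_trans _ le_lr) // ltn_add2l.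
by rewrite (leading_eq0 lP) // (homog_coef hP) ?mul0r ?ltn_eqF.
Qed.

Lemma leading1 : leading 0 1 1.
Proof. by split=> [|m _]; rewrite ?dhomog1 // mcoeff1. Qed.

Lemma leadingX a f P e : leading a f P -> leading (e * a) (f ^+ e) (P ^+ e).
Proof.
move=> lf; elim: e => [|e IHe]; first exact: leading1.
by rewrite !exprS mulSn; apply: leadingM.
Qed.

Lemma leading_var i : leading 1 (fps_var K i) 'X_i.
Proof.
by split=> [|m _]; rewrite ?dhomogX /= ?mdeg1 // mcoeffX eq_sym.
Qed.

Lemma leading_deriv a i f P :
  leading a.+1 f P -> leading a (fps_deriv i f) P^`M(i).
Proof.
case=> hP fP; split=> [|m le_ma]; last first.
  by rewrite mcoeff_deriv /= fP // mdegD mdeg1 addn1.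
apply/dhomogP => m; rewrite mcoeff_msupp mcoeff_deriv /= => nz.
apply/eqP; apply: contraNT nz => ne_ma.
by rewrite (homog_coef hP) ?mul0rn // mdegD mdeg1 addn1 eqSS.
Qed.

End FpsCalculus.

(** The lowest order part of g, multiplied by P, would be the nonzero leading part of f g; hence g
    has arbitrarily high order. *)
Lemma leading_regular k (K : idomainType) a (f g : fps k K) P :
  leading a f P -> P != 0 -> f * g = 0 -> g = 0.
Proof.
move=> lf P0 fg0; suff ordg d : fps_order_ge d g.
  by apply: fpsP => m; apply: (ordg (mdeg m).+1).
elim: d => [//|d IHd] m; rewrite ltnS leq_eqVlt => /orP[/eqP md|]; last exact: IHd.
have lg := leading_trunc IHd.
have := leadingM lf lg; rewrite fg0 => /leading_unique/(_ (leading0 _ _ _))/eqP.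
rewrite mulf_eq0 (negPf P0) /= => /eqP tg0.
by rewrite -(@fps_truncE _ _ d.+1) ?md // tg0 mcoeff0.
Qed.

(** * CR vector fields and non-minimality *)

Section DerivationAlgebra.
Variables (S : comNzRingType) (n : nat) (o1 on : 'I_n).
Variables (dz db : 'I_n -> S -> S) (cj : {rmorphism S -> S}).
Hypothesis dzD : forall j, {morph dz j : x y / x + y}.
Hypothesis dbD : forall j, {morph db j : x y / x + y}.
Hypothesis dzM : forall j x y, dz j (x * y) = dz j x * y + x * dz j y.
Hypothesis dbM : forall j x y, db j (x * y) = db j x * y + x * db j y.
Hypothesis dz_db : forall i j x, dz i (db j x) = db j (dz i x).
Hypothesis cjK : involutive cj.
Hypothesis cj_dz : forall j x, cj (dz j x) = db j (cj x).
Implicit Types (phi f g x y s t : S) (i j k : 'I_n).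

Lemma derivation_N (d : S -> S) : {morph d : x y / x + y} -> {morph d : x / - x}.
Proof.
move=> dD x; have d0 : d 0 = 0.
  by apply: (addrI (d 0)); rewrite -dD !addr0.
by apply: (addrI (d x)); rewrite -dD !subrr.
Qed.
Let dzN j : {morph dz j : x / - x}. Proof. exact: derivation_N. Qed.
Let dbN j : {morph db j : x / - x}. Proof. exact: derivation_N. Qed.
Let cj_db j x : cj (db j x) = dz j (cj x).
Proof. by rewrite -[in LHS](cjK x) -cj_dz cjK. Qed.

(* The (1,0) and (0,1) vector fields tangent to w = phi, in the coordinates z:
   they annihilate [cj phi] and [phi] respectively. *)
Definition cr_z phi j x : S :=
  dz on (cj phi) * dz j x - dz j (cj phi) * dz on x.
Definition cr_b phi k x : S := db on phi * db k x - db k phi * db on x.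

Definition levi_form phi f j k : S :=
  dz on (cj phi) * db on phi * dz j (db k f)
  - dz on (cj phi) * db k phi * dz j (db on f)
  - dz j (cj phi) * db on phi * dz on (db k f)
  + dz j (cj phi) * db k phi * dz on (db on f).

Lemma conj_levi_form phi f j k :
  cj (levi_form phi f j k) = levi_form phi (cj f) k j.
Proof.
rewrite /levi_form rmorphD !rmorphB !rmorphM /= !(cj_db, cj_dz) cjK !dz_db; ring.
Qed.

Lemma cr_zM phi j x y :
  cr_z phi j (x * y) = cr_z phi j x * y + x * cr_z phi j y.
Proof. rewrite /cr_z !dzM; ring. Qed.
Lemma cr_zD phi j x y : cr_z phi j (x + y) = cr_z phi j x + cr_z phi j y.
Proof. rewrite /cr_z !dzD; ring. Qed.
Lemma cr_zN phi j x : cr_z phi j (- x) = - cr_z phi j x.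
Proof. rewrite /cr_z !dzN; ring. Qed.

Lemma conj_cr_b phi k x : cj (cr_b phi k x) = cr_z phi k (cj x).
Proof. by rewrite /cr_z rmorphB !rmorphM /= !cj_db. Qed.

(* Up to sign, [levi_wronskian phi] and [levi_form phi phi o1 o1] are 2 x 2 minors
   of the 3 x 3 Wronskian along [cr_z phi o1] whose vanishing is condition (c). *)
Definition levi_wronskian phi : S :=
  db on phi * levi_form phi (cj phi) o1 o1
  - db on (cj phi) * levi_form phi phi o1 o1.

Definition non_minimal phi : Prop :=
  (forall j k, j != on -> k != on -> k != o1 ->
     levi_form phi phi j k * levi_form phi (cj phi) o1 o1
     = levi_form phi phi o1 o1 * levi_form phi (cj phi) j k)
  /\ levi_wronskian phi * cr_z phi o1 (levi_form phi phi o1 o1)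
     = levi_form phi phi o1 o1 * cr_z phi o1 (levi_wronskian phi).

(* The change of coordinates replaces [phi] by [phi + s], where [s = f(z, phi)],
   [t = f_w(z, phi)] and [v j = f_(z_j)(z, phi)]. *)
Lemma non_minimalD phi s t t' (v v' : 'I_n -> S) :
    (forall k, db k s = t * db k phi) ->
    (forall j, dz j s = v j + t * dz j phi) ->
    (forall k, db k t = t' * db k phi) ->
    (forall j k, db k (v j) = v' j * db k phi) ->
  non_minimal phi -> non_minimal (phi + s).
Proof.
move=> dbs dzs dbt dbv [prop wr].
pose ub := 1 + t; pose u := cj ub.
have Ab k : db k (phi + s) = ub * db k phi by rewrite dbD dbs /ub; ring.
have A j : dz j (cj (phi + s)) = u * dz j (cj phi).
  by rewrite -!cj_db Ab rmorphM.
(* The terms in the derivatives of [ub] cancel along the tangent directions. *)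
have leviE j k : levi_form (phi + s) (phi + s) j k
    = u * ub ^+ 2 * levi_form phi phi j k.
  rewrite /levi_form !A !Ab !dzM; ring.
have levi'E j k : levi_form (phi + s) (cj (phi + s)) j k
    = u ^+ 2 * ub * levi_form phi (cj phi) j k.
  have cju : cj u = ub by rewrite /u cjK.
  rewrite -conj_levi_form leviE !rmorphM /= conj_levi_form cju -/u; ring.
have crE j x : cr_z (phi + s) j x = u * cr_z phi j x.
  by rewrite /cr_z !A; ring.
(* For [cr_z], conjugates of holomorphic functions of (z, w) on the graph are constants; [u] and the
   conjugate of [v on] are of this kind. *)
have cr0 x x' : (forall k, db k x = x' * db k phi) -> cr_z phi o1 (cj x) = 0.
  move=> dx; rewrite -conj_cr_b (_ : cr_b _ _ _ = 0) ?rmorph0 //.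
  by rewrite /cr_b !dx; ring.
have cru : cr_z phi o1 u = 0.
  apply: (cr0 _ t') => k; rewrite /ub dbD dbt.
  suff -> : db k 1 = 0 by rewrite add0r.
  by apply: (addrI (db k 1)); rewrite addr0 -{3}[1]mulr1 dbM mulr1 mul1r.
have crv : cr_z phi o1 (cj (v on)) = 0 by apply: (cr0 _ (v' on)).
have psi_n : db on (cj (phi + s)) = cj (v on) + u * db on (cj phi).
  rewrite -cj_dz dzD dzs /u /ub !rmorphD rmorphM rmorph1 /= cj_dz; ring.
split=> [j k jn kn k1|].
  rewrite !leviE !levi'E.
  transitivity (u ^+ 3 * ub ^+ 3 *
    (levi_form phi phi j k * levi_form phi (cj phi) o1 o1)); first by ring.
  by rewrite prop //; ring.
set N := levi_form phi phi o1 o1 in wr *.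
(* Up to the factor [ka], W becomes a constant multiple of W plus a constant multiple of N, for
   constants of [cr_z]. The Wronskian of W and N is thereby only rescaled, as it is by the common
   factor [ka]. *)
pose X := u * levi_wronskian phi - cj (v on) * N.
have W'E : levi_wronskian (phi + s) = u * ub ^+ 2 * X.
  by rewrite /X /levi_wronskian leviE levi'E psi_n Ab -/N; ring.
have crX : cr_z phi o1 X
    = u * cr_z phi o1 (levi_wronskian phi) - cj (v on) * cr_z phi o1 N.
  by rewrite /X cr_zD cr_zN !cr_zM cru crv; ring.
set ka := u * ub ^+ 2 in W'E leviE.
rewrite W'E leviE -/N !crE !(cr_zM _ _ ka) crX.
set crN := cr_z phi o1 N in wr *; set crW := cr_z phi o1 (levi_wronskian phi) in wr *.
transitivity (u * ka * X * cr_z phi o1 ka * N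
  + u * ka ^+ 2 * (u * (levi_wronskian phi * crN) - cj (v on) * N * crN)).
  by rewrite /X; ring.
by rewrite wr /X; ring.
Qed.

Section ConditionsAbc.
Variable phi : S.
Hypothesis phi_regular : forall x, dz on phi * x = 0 -> x = 0.

Local Notation A := (dz on (cj phi)).
Local Notation C j := (cr_z phi j phi).
Local Notation l1 j k := (cr_z phi j (db on phi)).
Local Notation l2 j k := (- cr_z phi j (db k phi)).
Local Notation l3 j k := (cr_z phi j (cj (C k))).
Local Notation l4 j k := (- cr_b phi k A).
Local Notation l6 j k := (- cr_b phi k (C j)).
Local Notation Gamma l := (cr_z phi o1 l).

Let levi_l12 j k :
  db on phi * l2 j k + db k phi * l1 j k = - levi_form phi phi j k.
Proof. rewrite /levi_form /cr_z; ring. Qed.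

Let levi_l46 j k : A * l6 j k - C j * l4 j k
  = - (A * levi_form phi phi j k - dz on phi * levi_form phi (cj phi) j k).
Proof.
have dbB i x y : db i (x - y) = db i x - db i y by rewrite dbD dbN.
rewrite /levi_form /cr_z /cr_b !(dbB, dbM) !dz_db; ring.
Qed.

(** In (a) and (b) the terms with the factor A cancel, leaving [dz on phi] times the
    proportionality, and [phi_regular] removes this factor. In (c) the four factors are, up to sign,
    N, W and their derivatives along [cr_z phi o1]. *)
Lemma non_minimal_of_abc :
    (forall j k, j != on -> k != on -> k != o1 ->
      (db on phi * l2 j k + db k phi * l1 j k) * (A * l6 o1 o1 - C o1 * l4 o1 o1)
      = (db on phi * l2 o1 o1 + db o1 phi * l1 o1 o1)
        * (A * l6 j k - C j * l4 j k)) ->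
    (db on phi * Gamma (l2 o1 o1) + Gamma (l1 o1 o1) * db o1 phi)
      * (db on phi * l3 o1 o1 - l1 o1 o1 * cj (C o1))
    = (db on phi * Gamma (l3 o1 o1) - Gamma (l1 o1 o1) * cj (C o1))
      * (db on phi * l2 o1 o1 + l1 o1 o1 * db o1 phi) ->
  non_minimal phi.
Proof.
move=> ab c; split=> [j k jn kn k1|].
  apply/eqP; rewrite -subr_eq0; apply/eqP; apply: phi_regular.
  have := ab j k jn kn k1; rewrite !levi_l12 !levi_l46 => e.
  apply/eqP; rewrite -subr_eq0; apply/eqP.
  set x := levi_form phi phi j k in e *.
  set y := levi_form phi phi o1 o1 in e *.
  set x' := levi_form phi (cj phi) j k in e *.
  set y' := levi_form phi (cj phi) o1 o1 in e *.
  transitivity (- y * - (A * x - dz on phi * x') - - x * - (A * y - dz on phi * y')).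
    by ring.
  by rewrite e subrr.
have conjC : cj (C o1) = db on phi * db o1 (cj phi) - db o1 phi * db on (cj phi).
  by rewrite /cr_z rmorphB !rmorphM /= !cj_dz cjK.
set N := levi_form phi phi o1 o1; set W := levi_wronskian phi.
have N_E : db on phi * l2 o1 o1 + l1 o1 o1 * db o1 phi = - N.
  by rewrite [l1 o1 o1 * _]mulrC levi_l12.
have W_E : W = db on phi * l3 o1 o1 - l1 o1 o1 * cj (C o1).
  have dzB i x y : dz i (x - y) = dz i x - dz i y by rewrite dzD dzN.
  rewrite /W /levi_wronskian conjC /levi_form /cr_z !(dzB, dzM); ring.
have crW_E : cr_z phi o1 W
    = db on phi * Gamma (l3 o1 o1) - Gamma (l1 o1 o1) * cj (C o1).
  rewrite W_E cr_zD cr_zN !cr_zM; ring.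
have crN_E : - cr_z phi o1 N
    = db on phi * Gamma (l2 o1 o1) + Gamma (l1 o1 o1) * db o1 phi.
  rewrite -cr_zN -N_E cr_zD !cr_zM; ring.
move: c; rewrite -W_E -crW_E -crN_E N_E => c.
by rewrite [RHS]mulrC -[RHS]opprK -mulrN -c mulNr opprK mulrC.
Qed.

End ConditionsAbc.

(** It is used with r = 2i and g = Im phi. For fixed vector fields, the proportionality and
    [levi_wronskian] are antisymmetric in phi and [cj phi]; the terms free of r cancel and r can be
    divided out. What remains is linear in g, apart from a factor whose leading part comes from
    q. *)
Lemma non_minimal_im phi g r :
    (forall x, r * x = 0 -> x = 0) ->
    (forall j, dz j r = 0) -> (forall j, db j r = 0) ->
    phi = cj phi + r * g -> non_minimal phi ->
  (forall j k, j != on -> k != on -> k != o1 ->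
     levi_form phi g j k * levi_form phi (cj phi) o1 o1
     = levi_form phi g o1 o1 * levi_form phi (cj phi) j k)
  /\ let w := db on g * levi_form phi (cj phi) o1 o1
              - db on (cj phi) * levi_form phi g o1 o1 in
     w * cr_z phi o1 (levi_form phi phi o1 o1)
     = levi_form phi phi o1 o1 * cr_z phi o1 w.
Proof.
move=> reg_r dzr dbr phiE [prop wr].
have leviE j k : levi_form phi phi j k
    = levi_form phi (cj phi) j k + r * levi_form phi g j k.
  have mixed i l : dz i (db l phi) = dz i (db l (cj phi)) + r * dz i (db l g).
    by rewrite {1}phiE dbD dbM dbr dzD mul0r add0r dzM dzr mul0r add0r.
  rewrite {1}/levi_form !mixed /levi_form; ring.
split=> [j k jn kn k1|].
  apply/eqP; rewrite -subr_eq0; apply/eqP; apply: reg_r.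
  have := prop j k jn kn k1; rewrite !leviE => e.
  transitivity ((levi_form phi (cj phi) j k + r * levi_form phi g j k)
                * levi_form phi (cj phi) o1 o1
    - (levi_form phi (cj phi) o1 o1 + r * levi_form phi g o1 o1)
      * levi_form phi (cj phi) j k); first by ring.
  by rewrite e subrr.
move=> /=; set w := _ - _.
have WE : levi_wronskian phi = r * w.
  rewrite /levi_wronskian leviE [db on phi](_ : _ = db on (cj phi) + r * db on g).
    by rewrite /w; ring.
  by rewrite {1}phiE dbD dbM dbr mul0r add0r.
apply/eqP; rewrite -subr_eq0; apply/eqP; apply: reg_r.
have cr_r : cr_z phi o1 r = 0 by rewrite /cr_z !dzr; ring.
rewrite mulrBr; apply/eqP; rewrite subr_eq0; apply/eqP.
move: wr; rewrite WE cr_zM cr_r mul0r add0r => wr.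
by rewrite mulrA wr; ring.
Qed.

End DerivationAlgebra.

(** * Conjugation of formal series and substitution on the graph *)

Section FormalSeries.
Variables (R : realType) (n : nat).
Local Notation C := R[i].
Local Notation series := (fps (n + n) C).
Implicit Types (f g phi : series) (i j k : 'I_n) (p : {mpoly C[n + 1]}).

Fact fps_conj_is_zmod_morphism : zmod_morphism (@fps_conj R n).
Proof. by move=> f g; apply: fpsP => m /=; rewrite rmorphB. Qed.

Lemma fps_trunc_conj d f l : (mdeg l < d)%N ->
  (mpoly_conj (fps_trunc d f))@_l = (fps_trunc d (fps_conj f))@_l.
Proof.
by move=> lt_ld; rewrite mcoeff_conj !fps_truncE ?mdeg_swap.
Qed.

Fact fps_conj_is_monoid_morphism : monoid_morphism (@fps_conj R n).
Proof.
split=> [|f g]; apply: fpsP => m.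
  rewrite -[LHS]/(((mnm_swap m == 0%MM)%:R : C)^*) rmorph_nat.
  rewrite -[RHS]/((m == 0%MM)%:R : C); congr ((_ : bool)%:R).
  by rewrite -!mdeg_eq0 mdeg_swap.
rewrite -[LHS]/(((f * g) (mnm_swap m))^*) !(@fps_coefM _ _ (mdeg m).+1) ?mdeg_swap //.
rewrite -mcoeff_conj rmorphM; apply: mcoeffM_eq => l le_lm.
  by rewrite fps_trunc_conj.
by rewrite fps_trunc_conj.
Qed.

HB.instance Definition _ :=
  GRing.isZmodMorphism.Build _ _ (@fps_conj R n) fps_conj_is_zmod_morphism.
HB.instance Definition _ :=
  GRing.isMonoidMorphism.Build _ _ (@fps_conj R n) fps_conj_is_monoid_morphism.

Lemma fps_conjK : involutive (@fps_conj R n).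
Proof.
move=> f; apply: fpsP => m; rewrite /= conjCK; congr (f _).
by apply/mnmP => i; rewrite !mnmE swap_barK.
Qed.

Lemma fps_conjZ c f : fps_conj (c *: f) = c^* *: fps_conj f.
Proof. by apply: fpsP => m /=; rewrite rmorphM. Qed.

Lemma fps_conj_d_z j f : fps_conj (d_z j f) = d_zbar j (fps_conj f).
Proof.
apply: fpsP => m /=; rewrite rmorphMn /= -!/(mnm_swap _) mnm_swapD mnm_swapU.
by rewrite swap_bar_rshift mnmE swap_bar_lshift.
Qed.

Lemma leading_conj a f P : leading a f P -> leading a (fps_conj f) (mpoly_conj P).
Proof.
case=> hP fP; split=> [|m le_ma]; last first.
  by rewrite mcoeff_conj /= -/(mnm_swap m) fP // mdeg_swap.
apply/dhomogP => m; rewrite mcoeff_msupp mcoeff_conj conjC_eq0 => nz.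
apply/eqP; apply: contraNT nz => ne_ma.
by rewrite (homog_coef hP) // mdeg_swap.
Qed.

Lemma leading_d_z a j f P : leading a.+1 f P -> leading a (d_z j f) (dz j P).
Proof. by move=> lf; rewrite dzE; apply: leading_deriv. Qed.
Lemma leading_d_zbar a j f P :
  leading a.+1 f P -> leading a (d_zbar j f) (db j P).
Proof. by move=> lf; rewrite dbE; apply: leading_deriv. Qed.

Definition zw_var phi (l : 'I_(n + 1)) : series :=
  match split l with inl j => z_ R j | inr _ => phi end.

(** Polynomial counterpart of [restrict_to_graph]: as a morphism given by its values on the
    variables, it obeys [deriv_mmap]. *)
Definition at_graph phi p : series := mmap (in_alg series) (zw_var phi) p.

Lemma zw_varZ phi j : zw_var phi (lshift 1 j) = z_ R j.
Proof.
by rewrite /zw_var; case: split_ordP => l /eqP; rewrite eq_shift // => /eqP ->.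
Qed.
Lemma zw_varW phi : zw_var phi (rshift n ord0) = phi.
Proof. by rewrite /zw_var; case: split_ordP => l /eqP; rewrite eq_shift. Qed.

Lemma fps_deriv_var (i j : 'I_(n + n)) :
  fps_deriv i (fps_var C j) = (j == i)%:R.
Proof.
apply: fpsP => m; transitivity (('X_j : {mpoly C[n + n]})^`M(i)@_m).
  by rewrite mcoeff_deriv mcoeffX /= eq_sym.
by rewrite mderivXU; case: (j == i); [apply: mcoeff1 | apply: mcoeff0].
Qed.

Lemma d_z_z i j : d_z i (z_ R j) = (j == i)%:R.
Proof. by rewrite /d_z fps_deriv_var (inj_eq (@lshift_inj _ _)). Qed.
Lemma d_zbar_z i j : d_zbar i (z_ R j) = 0.
Proof. by rewrite /d_zbar fps_deriv_var eq_lrshift. Qed.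

Lemma d_z_at_graph phi p j : d_z j (at_graph phi p)
  = at_graph phi p^`M(lshift 1 j) + at_graph phi p^`M(rshift n ord0) * d_z j phi.
Proof.
rewrite /at_graph (deriv_mmap _ (d := d_z j)) => [|x y|x y|c].
- rewrite big_split_ord big_ord1 zw_varW /=; congr (_ + _).
  rewrite (bigD1 j) //= big1 => [|i ne_ij].
    by rewrite addr0 zw_varZ d_z_z eqxx mulr1.
  by rewrite zw_varZ d_z_z (negPf ne_ij) mulr0.
- exact: fps_derivD.
- exact: fps_derivM.
- exact: fps_derivC.
Qed.

Lemma d_zbar_at_graph phi p j : d_zbar j (at_graph phi p)
  = at_graph phi p^`M(rshift n ord0) * d_zbar j phi.
Proof.
rewrite /at_graph (deriv_mmap _ (d := d_zbar j)) => [|x y|x y|c].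
- rewrite big_split_ord big_ord1 zw_varW /= big1 => [|i _].
    by rewrite add0r.
  by rewrite zw_varZ d_zbar_z mulr0.
- exact: fps_derivD.
- exact: fps_derivM.
- exact: fps_derivC.
Qed.

Lemma leading_sum (I : eqType) a (s : seq I) (f : I -> series)
    (P : I -> {mpoly C[n + n]}) :
    (forall x, x \in s -> leading a (f x) (P x)) ->
  leading a (\sum_(x <- s) f x) (\sum_(x <- s) P x).
Proof.
elim: s => [|x s IHs] lf; first by rewrite !big_nil; apply: leading0.
rewrite !big_cons; apply: leadingD; first by apply: lf; rewrite mem_head.
by apply: IHs => y ys; apply: lf; rewrite in_cons ys orbT.
Qed.

Variable lam : 'I_n -> C.

Lemma leading_at_graphX phi m : leading 2 phi (qq lam) ->
  leading (zw_weight m) (at_graph phi 'X_[m]) (at_q lam 'X_[m]).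
Proof.
move=> lphi; rewrite /at_graph /at_q !mmapX /mmap1 !big_split_ord !big_ord1 /=.
apply: leadingM; last first.
  by rewrite zw_varW at_q_varW mulnC; apply: leadingX.
elim/big_rec3: _ => [|j g P d _ lg]; first exact: leading1.
apply: leadingM lg; rewrite zw_varZ at_q_varZ -[X in leading X _ _]muln1.
by apply: leadingX; apply: leading_var.
Qed.

Lemma at_graphE phi p :
  at_graph phi p = \sum_(m <- msupp p) p@_m *: at_graph phi 'X_[m].
Proof.
rewrite /at_graph /mmap; apply: eq_bigr => m _.
by rewrite -[mmap1 _ _]/(_) mulr_algl -[in RHS]/(mmap _ _ _) mmapX.
Qed.

Lemma at_qE p : at_q lam p = \sum_(m <- msupp p) p@_m *: at_q lam 'X_[m].
Proof.
rewrite /at_q {1}/mmap; apply: eq_bigr => m _.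
by rewrite mul_mpolyC mmapX.
Qed.

Lemma leading_at_graph phi p d : leading 2 phi (qq lam) ->
    {in msupp p, forall m, zw_weight m = d} ->
  leading d (at_graph phi p) (at_q lam p).
Proof.
move=> lphi wp; rewrite at_graphE at_qE; apply: leading_sum => m mp.
by apply: leadingZ; rewrite -(wp m mp); apply: leading_at_graphX.
Qed.

Lemma leading_at_graph0 phi p d : leading 2 phi (qq lam) ->
    {in msupp p, forall m, (d < zw_weight m)%N} -> leading d (at_graph phi p) 0.
Proof.
move=> lphi wp; rewrite at_graphE.
suff : leading d (\sum_(m <- msupp p) p@_m *: at_graph phi 'X_[m])
                 (\sum_(m <- msupp p) p@_m *: 0).
  by rewrite [X in leading _ _ X]big1 // => m _; rewrite scaler0.
apply: leading_sum => m mp; apply: leadingZ.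
by apply: leading_lt (wp m mp); apply: leading_at_graphX.
Qed.

End FormalSeries.

(** * Flattening order by order *)

Section Flattening.
Variables (R : realType) (n : nat) (n_gt1 : (1 < n)%N) (lambda : 'I_n -> R).
Hypothesis lambda_ge0 : forall i, 0 <= lambda i.
Hypothesis lambda_neq_half : exists i, lambda i <> 2^-1.
Local Notation C := R[i].
Local Notation series := (fps (n + n) C).
Local Notation o1 := (idx1 n_gt1).
Local Notation on := (idxn n_gt1).
Local Notation bar := (@fps_conj R n).
Local Notation levi_form := (levi_form on (@d_z R n) (@d_zbar R n) bar).
Local Notation cr_z := (cr_z on (@d_z R n) bar).
Local Notation non_minimal := (non_minimal o1 on (@d_z R n) (@d_zbar R n) bar).
Implicit Types (f g phi : series) (j k : 'I_n) (p F : {mpoly C[n + 1]}).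

Definition lam (i : 'I_n) : C := (lambda i)%:C%C.
Local Notation qq := (qq lam).
Local Notation at_q := (at_q lam).

Lemma lam_ge0 i : 0 <= lam i. Proof. by rewrite /lam ler0c. Qed.

Lemma lam_neq_half : exists i, lam i != 2^-1.
Proof.
have [i li] := lambda_neq_half; exists i; apply/eqP => e; apply: li.
by apply: (@complexI R); rewrite fmorphV rmorph_nat -[LHS]/(lam i) e.
Qed.

Lemma idx1_neq_idxn : o1 != on.
Proof.
apply/eqP => /(congr1 val) /= e; move: n_gt1.
by rewrite -(prednK (ltnW n_gt1)) -e.
Qed.

Lemma two_i_neq0 : 2 * 'i != 0 :> C.
Proof. by rewrite mulf_neq0 ?neq0Ci ?pnatr_eq0. Qed.

Lemma two_i_regular f : (2 * 'i)%:A * f = 0 -> f = 0.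
Proof.
rewrite mulr_algl => /(congr1 ( *:%R (2 * 'i)^-1)).
by rewrite scalerA mulVf ?two_i_neq0 // scale1r scaler0.
Qed.

Lemma fps_ImE phi : phi = bar phi + (2 * 'i)%:A * fps_Im phi.
Proof.
by rewrite mulr_algl /fps_Im scalerA mulfV ?two_i_neq0 // scale1r addrC subrK.
Qed.

Lemma conj_two_i : (2 * 'i)^* = - (2 * 'i) :> C.
Proof. by rewrite rmorphM rmorph_nat /= conjCi mulrN. Qed.

Lemma fps_ImD f g : fps_Im (f + g) = fps_Im f + fps_Im g.
Proof. by rewrite /fps_Im rmorphD opprD addrACA scalerDr. Qed.

Lemma conj_fps_Im phi : bar (fps_Im phi) = fps_Im phi.
Proof.
rewrite /fps_Im fps_conjZ rmorphB /= fps_conjK fmorphV /= conj_two_i invrN.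
by rewrite scaleNr -scalerN opprB.
Qed.

Section Leading.
Variable phi : series.
Hypothesis lead_phi : leading 2 phi qq.

Lemma leading_bar : leading 2 (bar phi) qq.
Proof. by rewrite -(conj_qq lam_ge0); apply: leading_conj. Qed.

Lemma leading_A j : leading 1 (d_z j (bar phi)) (qz lam j).
Proof. by rewrite -dz_qq; apply/leading_d_z/leading_bar. Qed.

Lemma leading_Ab j : leading 1 (d_zbar j phi) (qb lam j).
Proof. by rewrite -(db_qq lam_ge0); apply/leading_d_zbar. Qed.

Lemma leading_levi a f P j k : leading a.+2 f P ->
  leading a.+2 (levi_form phi f j k) (levi lam on P j k).
Proof.
move=> lf; have mixed i l := leading_d_z i (leading_d_zbar l lf).
have term i1 i2 i l := leadingM (leadingM (leading_A i1) (leading_Ab i2)) (mixed i l).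
apply: leadingD; last exact: term.
by apply: leadingB; last exact: term; apply: leadingB; exact: term.
Qed.

Lemma leading_cr_z a f P j : leading a.+1 f P ->
  leading a.+1 (cr_z phi j f) (tan_z lam on j P).
Proof.
move=> lf; have term i l := leadingM (leading_A i) (leading_d_z l lf).
by apply: leadingB; apply: term.
Qed.

End Leading.

Lemma d_zD j : {morph @d_z R n j : x y / x + y}.
Proof. exact: fps_derivD. Qed.
Lemma d_zbarD j : {morph @d_zbar R n j : x y / x + y}.
Proof. exact: fps_derivD. Qed.
Lemma d_zM j f g : d_z j (f * g) = d_z j f * g + f * d_z j g.
Proof. exact: fps_derivM. Qed.
Lemma d_zbarM j f g : d_zbar j (f * g) = d_zbar j f * g + f * d_zbar j g.
Proof. exact: fps_derivM. Qed.
Lemma d_z_d_zbar j k f : d_z j (d_zbar k f) = d_zbar k (d_z j f).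
Proof. exact: fps_deriv_comm. Qed.
Lemma d_zC j (c : C) : d_z j (c%:A : series) = 0.
Proof. exact: fps_derivC. Qed.
Lemma d_zbarC j (c : C) : d_zbar j (c%:A : series) = 0.
Proof. exact: fps_derivC. Qed.

Lemma non_minimal_at_graph phi p :
  non_minimal phi -> non_minimal (phi + at_graph phi p).
Proof.
apply: (non_minimalD d_zD d_zbarD d_zM d_zbarM d_z_d_zbar (@fps_conjK R n)
  (@fps_conj_d_z R n)).
- exact: d_zbar_at_graph.
- exact: d_z_at_graph.
- exact: d_zbar_at_graph.
- by move=> j k; apply: d_zbar_at_graph.
Qed.

(** The correction is evaluated at the original [phi0], not at phi. Both have the leading part q, so
    the term to be removed is matched all the same, and the corrections of successive steps add
    up. *)
Lemma flatten_step phi0 phi m : leading 2 phi0 qq -> leading 2 phi qq ->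
    non_minimal phi -> (2 < m)%N -> fps_order_ge m (fps_Im phi) ->
  exists2 F, {in msupp F, forall l, zw_weight l = m}
    & fps_order_ge m.+1 (fps_Im (phi + at_graph phi0 F)).
Proof.
move=> lead0 lead nm m_gt2 ordE.
case: m m_gt2 ordE => [|[|m]] // _ ordE; set E := fps_Im phi in ordE *.
pose e := fps_trunc m.+3 E; have leadE : leading m.+2 E e by apply: leading_trunc.
have realE : mpoly_conj e = e.
  apply: (leading_unique (f := E) _ leadE); rewrite -[E in leading _ E]conj_fps_Im.
  exact: leading_conj leadE.
have [prop tang] := non_minimal_im d_zD d_zbarD d_zM d_zbarM (@two_i_regular)
  (d_zC^~ _) (d_zbarC^~ _) (fps_ImE phi) nm.
have levE j k := leading_levi lead j k leadE.
have levq j k := leading_levi lead j k lead.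
have levq' j k := leading_levi lead j k (leading_bar lead).
have prop_e j k : j != on -> k != on -> k != o1 ->
    levi lam on e j k * levi_det lam o1 on
    = levi lam on e o1 o1 * levi lam on qq j k.
  move=> jn kn k1; rewrite -(levi_qq11 lam_ge0 idx1_neq_idxn).
  apply: (leading_unique (leadingM (levE j k) (levq' o1 o1))).
  rewrite (prop j k jn kn k1); exact: leadingM.
have tang_e :
    let w := db on e * levi_det lam o1 on - qb lam on * levi lam on e o1 o1 in
    w * tan_z lam on o1 (levi_det lam o1 on)
    = levi_det lam o1 on * tan_z lam on o1 w.
  rewrite -(levi_qq11 lam_ge0 idx1_neq_idxn) /=.
  have l1 := leadingM (leading_d_zbar on leadE) (levq' o1 o1).
  have l2 := leadingM (leading_Ab (leading_bar lead) on) (levE o1 o1).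
  rewrite addn2 in l1; rewrite add1n in l2; have leadw := leadingB l1 l2.
  have t1 := leadingM leadw (leading_cr_z lead o1 (levq o1 o1)).
  have t2 := leadingM (levq o1 o1) (leading_cr_z lead o1 leadw).
  rewrite [(m.+3 + 2)%N]addnC in t1; apply: (leading_unique t1).
  by move: tang => /= ->; apply: t2.
have [F0 wF0 eF0] := leading_flat lam_ge0 idx1_neq_idxn leadE.1 realE
  prop_e tang_e lam_neq_half.
exists ((- (2 * 'i)) *: F0) => [l /msuppZ_le|]; first exact: wF0.
have wF : {in msupp ((- (2 * 'i)) *: F0), forall l, zw_weight l = m.+2}.
  by move=> l /msuppZ_le; apply: wF0.
have leads := leading_at_graph lead0 wF.
have := leadingD leadE (leadingZ (2 * 'i)^-1 (leadingB leads (leading_conj leads))).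
rewrite -[_ *: (_ - fps_conj _)]/(fps_Im _) -fps_ImD.
rewrite [X in leading _ _ X](_ : _ = 0); first exact: leading_order.
have -> : at_q ((- (2 * 'i)) *: F0) = (- (2 * 'i)) *: at_q F0.
  by rewrite -!mul_mpolyC rmorphM /= [at_q _%:MP]mmapC.
have -> : mpoly_conj ((- (2 * 'i)) *: at_q F0) = (2 * 'i) *: mpoly_conj (at_q F0).
  by rewrite -!mul_mpolyC rmorphM /= mpoly_conjC rmorphN /= conj_two_i opprK.
rewrite scaleNr -opprD -scalerDr -eF0 scalerN scalerA mulVf ?two_i_neq0 //.
by rewrite scale1r subrr.
Qed.

End Flattening.

(** * Iteration, and non-minimality in terms of phi *)

Section FlatteningInduction.
Variables (R : realType) (n : nat) (n_gt1 : (1 < n)%N) (lambda : 'I_n -> R).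
Hypothesis lambda_ge0 : forall i, 0 <= lambda i.
Hypothesis lambda_neq_half : exists i, lambda i <> 2^-1.
Local Notation C := R[i].
Local Notation series := (fps (n + n) C).
Local Notation o1 := (idx1 n_gt1).
Local Notation on := (idxn n_gt1).
Local Notation bar := (@fps_conj R n).
Local Notation non_minimal := (non_minimal o1 on (@d_z R n) (@d_zbar R n) bar).
Local Notation qq := (qq (lam lambda)).
Implicit Types (phi : series) (p : {mpoly C[n + 1]}).

Lemma at_graphD phi p q : at_graph phi (p + q) = at_graph phi p + at_graph phi q.
Proof. exact: mmapD. Qed.

Lemma flatten_order phi m : leading 2 phi qq -> non_minimal phi ->
    fps_order_ge 3 (fps_Im phi) ->
  exists2 p, {in msupp p, forall l, (2 < zw_weight l)%N}
    & fps_order_ge (m + 3) (fps_Im (phi + at_graph phi p)).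
Proof.
move=> lead nm ord3; elim: m => [|m [p wp ordp]].
  by exists 0 => [l|]; rewrite ?msupp0 // /at_graph mmap0 addr0.
(* Weights above 2 do not affect the quadratic part. *)
have lead1 : leading 2 (phi + at_graph phi p) qq.
  by have := leadingD lead (leading_at_graph0 lead wp); rewrite [qq + 0]addr0.
have [|F wF ordF] := flatten_step (m := m + 3) lambda_ge0 lambda_neq_half
  lead lead1 (non_minimal_at_graph p nm) _ ordp.
  by rewrite addn3.
exists (p + F) => [l /msuppD_le|]; last by rewrite at_graphD addrA addSn.
rewrite mem_cat => /orP[|/wF ->]; [exact: wp | by rewrite addn3].
Qed.

Lemma leading_quadric : leading 2 (quadric lambda) qq.
Proof.
have lz i : leading 1 (z_ R i) (Z C i) := leading_var C (lshift n i).
have lzb i : leading 1 (zbar_ R i) (Zb C i) := leading_var C (rshift n i).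
apply: leading_sum => i _; rewrite mul_mpolyC; apply: leadingD.
  exact: (leadingM (lz i) (lzb i)).
apply: leadingZ; rewrite !expr2; apply: leadingD.
  exact: (leadingM (lz i) (lz i)).
exact: (leadingM (lzb i) (lzb i)).
Qed.

Lemma formally_non_minimalP (G E : series) :
    real_valued G -> real_valued E -> leading 2 (G + 'i *: E) qq ->
    formally_non_minimal n_gt1 G E ->
  non_minimal (G + 'i *: E).
Proof.
move=> realG realE lead [ca cb cc]; set phi := G + _ in lead *.
have conj_phi : bar phi = G - 'i *: E.
  by rewrite /phi rmorphD /= fps_conjZ realG realE conjCi scaleNr.
have AE j : d_z j (bar phi) = d_z j G - 'i *: d_z j E.
  by rewrite conj_phi d_zD -scaleNr [d_z j (_ *: _)]fps_derivZ scaleNr.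
have DE j : d_z j phi = d_z j G + 'i *: d_z j E.
  by rewrite /phi d_zD [d_z j (_ *: _)]fps_derivZ.
have barE j : bar (d_z j G - 'i *: d_z j E) = d_zbar j phi.
  by rewrite -AE fps_conj_d_z fps_conjK.
have CE j : nm_C n_gt1 G E j = cr_z on (@d_z R n) bar phi j phi.
  rewrite /nm_C /cr_z.
  rewrite !AE !DE -(mulr_algl (2 * 'i) (_ - _)).
  rewrite -(mulr_algl 'i (d_z on E)) -(mulr_algl 'i (d_z j E)).
  have -> : (2 * 'i)%:A = 2 * 'i%:A :> series.
    by rewrite -[LHS]/(in_alg series _) rmorphM rmorph_nat.
  move: (d_z _ G) (d_z _ E) (d_z j G) (d_z j E) ('i%:A : series) => a b c d I.
  ring.
have lA : nm_A n_gt1 G E = d_z on (bar phi) by rewrite AE.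
have lB j : nm_B G E j = d_z j (bar phi) by rewrite AE.
have barA : bar (nm_A n_gt1 G E) = d_zbar on phi by rewrite -barE.
have barB j : bar (nm_B G E j) = d_zbar j phi by rewrite -barE.
have NB (x y z t : series) : - x * y + z * t = - (x * y - z * t).
  by rewrite mulNr opprB addrC.
have L1 j k : nm_lambda1 n_gt1 G E j k
    = cr_z on (@d_z R n) bar phi j (d_zbar on phi).
  by rewrite /nm_lambda1 barA lA lB.
have L2 j k : nm_lambda2 n_gt1 G E j k
    = - cr_z on (@d_z R n) bar phi j (d_zbar k phi).
  by rewrite /nm_lambda2 barB lA lB NB.
have L3 j k : nm_lambda3 n_gt1 G E j k
    = cr_z on (@d_z R n) bar phi j (bar (cr_z on (@d_z R n) bar phi k phi)).
  by rewrite /nm_lambda3 CE lA lB.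
have L4 j k : nm_lambda4 n_gt1 G E j k
    = - cr_b on (@d_zbar R n) phi k (d_z on (bar phi)).
  by rewrite /nm_lambda4 barA barB lA NB.
have L6 j k : nm_lambda6 n_gt1 G E j k
    = - cr_b on (@d_zbar R n) phi k (cr_z on (@d_z R n) bar phi j phi).
  by rewrite /nm_lambda6 barA barB CE NB.
have LG l : nm_Gamma n_gt1 G E l = cr_z on (@d_z R n) bar phi o1 l.
  by rewrite /nm_Gamma lA lB.
refine (non_minimal_of_abc (@d_zD R n) (@d_zbarD R n) (@d_zM R n) (@d_zbarM R n)
  (@d_z_d_zbar R n) (@fps_conjK R n) (@fps_conj_d_z R n) _ _ _).
- move=> x; apply: leading_regular (leading_d_z on lead) _.
  by rewrite dz_qq qz_neq0 // => i; apply: lam_ge0.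
(* Condition (b) is the case j = 1, and (a) covers the other indices. *)
- move=> j k jn kn k1; have [->|j1] := eqVneq j o1.
    by have := cb k k1 kn; rewrite barA !barB !L1 !L2 !L6 !L4 lA !CE.
  by have := ca j k j1 jn k1 kn; rewrite barA !barB !L1 !L2 !L6 !L4 lA !CE.
by move: cc; rewrite barA !barB !LG !L1 !L2 !L3 !CE.
Qed.

End FlatteningInduction.

(** * Substitution into power series and into polynomials *)

Lemma big_bmnm_seq (V : nmodType) l d (s : seq 'X_{1..l}) (h : 'X_{1..l} -> V) :
    uniq s -> (forall a, a \notin s -> h a = 0) ->
    (forall a, (d <= mdeg a)%N -> h a = 0) ->
  \sum_(a : 'X_{1..l < d}) h a = \sum_(a <- s) h a.
Proof.
move=> uniq_s hs hd.
rewrite -(big_rmcond_in (fun a => (mdeg a < d)%N)) => [|a _]; last first.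
  by rewrite -leqNgt => /hd.
rewrite -big_filter (big_mksub 'X_{1..l < d}) /=.
- rewrite [RHS]big_rmcond_in // => a _; rewrite mem_filter bmdeg /=; exact: hs.
- exact: filter_uniq.
- by move=> a; rewrite mem_filter => /andP[].
Qed.

Definition mpoly_fps l (K : nzRingType) (p : {mpoly K[l]}) : fps l K :=
  Fps (fun m => p@_m).

Lemma fps_coef_sum (K : comNzRingType) l (I : Type) (s : seq I) (f : I -> fps l K) m :
  (\sum_(i <- s) f i) m = \sum_(i <- s) f i m.
Proof. by elim: s => [|i s IHs]; rewrite ?big_nil // !big_cons -IHs. Qed.

Section Graph.
Variables (R : realType) (n : nat).
Local Notation C := R[i].
Implicit Types (phi : fps (n + n) C) (p : {mpoly C[n + 1]}).

Lemma at_graphX_coef phi (a : 'X_{1..n + 1}) m : leading 1 phi 0 ->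
  (mdeg m < mdeg a)%N -> (at_graph phi 'X_[a]) m = 0.
Proof.
move=> lead; suff [P lP] : exists P, leading (mdeg a) (at_graph phi 'X_[a]) P.
  exact: leading_eq0 lP.
rewrite /at_graph mmapX /mmap1 mdegE.
elim/big_rec2: _ => [|l f d _ [P lP]]; first by exists 1; apply: leading1.
have [Q lQ] : exists Q, leading 1 (zw_var phi l) Q.
  rewrite /zw_var; case: split => [j|_]; last by exists 0.
  by exists 'X_(lshift n j); apply: leading_var.
exists (Q ^+ a l * P); apply: leadingM lP.
by have := leadingX (a l) lQ; rewrite muln1.
Qed.

(** As phi has no constant term, an exponent of degree above |m| contributes nothing to the
    coefficient of X^m; so the sum over bounded degrees and the sum over the support agree. *)
Lemma restrict_to_graphE phi p : leading 1 phi 0 ->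
  restrict_to_graph (mpoly_fps p) phi = at_graph phi p.
Proof.
move=> lead; rewrite at_graphE; apply: fpsP => m; rewrite fps_coef_sum.
rewrite -(@big_bmnm_seq _ _ (mdeg m).+1) ?msupp_uniq //.
- by apply: eq_bigr => a _; rewrite /at_graph mmapX.
- by move=> a /memN_msupp_eq0 -> /=; rewrite mul0r.
- by move=> a lt_ma; rewrite /= at_graphX_coef ?mulr0.
Qed.

End Graph.

(** * Convergence and growth of the change of coordinates *)

Section PolynomialGerm.
Variables (K : numFieldType).

Lemma mpoly_has_taylor_series l (p : {mpoly K[l]}) :
  has_taylor_series (fun x => p.@[fun i => x 0 i]) (mpoly_fps p).
Proof.
have FF : Filter (nbhs (0 : 'rV[K]_l)) by exact: nbhs_filter.
rewrite /has_taylor_series; apply: (@nearW _ (nbhs (0 : 'rV[K]_l)) _ FF) => x; split.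
  apply: (is_cvg_near_cst (\sum_(a <- msupp p) `|p@_a * monomial_at a x|)).
  exists (msize p) => // d /= le_pd; apply: big_bmnm_seq => [|a|a le_da].
  - exact: msupp_uniq.
  - by move/memN_msupp_eq0 ->; rewrite mul0r normr0.
  - by rewrite memN_msupp_eq0 ?mul0r ?normr0 // msize_mdeg_ge // (leq_trans le_pd).
apply: cvg_near_cst; exists (msize p) => // d /= le_pd.
rewrite /partial_sum mevalE.
apply: (big_bmnm_seq (h := fun a => p@_a * monomial_at a x)) => [|a|a le_da].
- exact: msupp_uniq.
- by move/memN_msupp_eq0 ->; rewrite mul0r.
- by rewrite memN_msupp_eq0 ?mul0r // msize_mdeg_ge // (leq_trans le_pd).
Qed.

End PolynomialGerm.

Section LittleO.
Variables (K : numFieldType) (n : nat).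
Implicit Types (a b : 'X_{1..n + 1}) (x : 'rV[K]_(n + 1)).

Lemma zw_weightD a b : zw_weight (a + b) = (zw_weight a + zw_weight b)%N.
Proof.
rewrite /zw_weight mnmDE mulnDr addnACA -big_split /=.
by congr (_ + _)%N; apply: eq_bigr => j _; rewrite mnmDE.
Qed.

Lemma zw_weightU (l : 'I_(n + 1)) :
  zw_weight U_(l) = (if split l is inl _ then 1 else 2)%N.
Proof.
rewrite /zw_weight; case: (split_ordP l) => j ->.
  rewrite mnm1E eq_lrshift muln0 addn0 (bigD1 j) //= mnm1E eqxx big1 // => i.
  by rewrite mnm1E (inj_eq (@lshift_inj _ _)) eq_sym => /negPf->.
rewrite mnm1E (ord1 j) eqxx muln1 big1 // => i _.
by rewrite mnm1E eq_rlshift.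
Qed.

Lemma monomialMU (l : 'I_(n + 1)) a x :
  monomial_at (U_(l) + a) x = x 0 l * monomial_at a x.
Proof.
rewrite /monomial_at (bigD1 l) //= [in RHS](bigD1 l) //= mulrA -exprS.
rewrite mnmDE mnm1E eqxx add1n; congr (_ * _); apply: eq_bigr => i ne_il.
by rewrite mnmDE mnm1E eq_sym (negPf ne_il).
Qed.

Lemma mnm_splitU a (l : 'I_(n + 1)) : a l != 0%N -> a = (U_(l) + (a - U_(l)))%MM.
Proof. by move=> al; rewrite addmC submK // lep1mP. Qed.

Lemma zw_weight_z a : a (rshift n ord0) = 0%N -> (0 < zw_weight a)%N ->
  exists j : 'I_n, a (lshift 1 j) != 0%N.
Proof.
rewrite /zw_weight => -> ; rewrite muln0 addn0 => pos; apply/existsP.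
apply: contraTT pos; rewrite negb_exists => /forallP a0.
by rewrite big1 // => j _; apply/eqP; rewrite -[_ == _]negbK a0.
Qed.

Lemma z_w_weight_ge0 x : 0 <= z_w_weight x.
Proof. by rewrite addr_ge0 ?sumr_ge0 // => i _; rewrite exprn_ge0. Qed.

Lemma z_w_weight_ge_w x : `|x 0 (rshift n ord0)| <= z_w_weight x.
Proof. by rewrite lerDr sumr_ge0 // => i _; rewrite exprn_ge0. Qed.

Lemma z_w_weight_ge_z x j : `|x 0 (lshift 1 j)| ^+ 2 <= z_w_weight x.
Proof.
rewrite /z_w_weight (bigD1 j) //= -addrA lerDl addr_ge0 // sumr_ge0 // => i _.
by rewrite exprn_ge0.
Qed.

Lemma monomial_le1 a x : (forall l, `|x 0 l| <= 1) -> `|monomial_at a x| <= 1.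
Proof.
move=> x1; rewrite /monomial_at; elim/big_rec: _ => [|l y _ y1].
  by rewrite normr1.
by rewrite normrM normrX mulr_ile1 ?exprn_ge0 ?exprn_ile1.
Qed.

(** Such a monomial contains w or two factors z_j, z_k, and |z_j z_k| is at most the larger of their
    squares. *)
Lemma monomial_le_weight a x : (forall l, `|x 0 l| <= 1) ->
  (1 < zw_weight a)%N -> `|monomial_at a x| <= z_w_weight x.
Proof.
move=> x1 wa; have [aw|/eqP aw] := altP (a (rshift n ord0) =P 0%N); last first.
  rewrite (mnm_splitU (introN eqP aw)) monomialMU normrM.
  apply: le_trans (z_w_weight_ge_w x).
  by rewrite ler_piMr // monomial_le1.
have [j aj] := zw_weight_z aw (ltnW wa).
set b := (a - U_(lshift 1 j))%MM.
have eab : a = (U_(lshift 1 j) + b)%MM by apply: mnm_splitU.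
have bw : b (rshift n ord0) = 0%N by rewrite mnmBE aw.
have wb : (0 < zw_weight b)%N.
  by move: wa; rewrite eab zw_weightD zw_weightU;
    case: split_ordP => l /eqP; rewrite eq_shift.
have [k bk] := zw_weight_z bw wb.
rewrite eab (mnm_splitU bk) !monomialMU !normrM mulrA.
apply: (@le_trans _ _ (`|x 0 (lshift 1 j)| * `|x 0 (lshift 1 k)|)).
  by rewrite ler_piMr ?mulr_ge0 // monomial_le1.
have [le_jk|/ltW le_kj] :=
  real_leP (normr_real (x 0 (lshift 1 j))) (normr_real (x 0 (lshift 1 k))).
  by apply: le_trans (z_w_weight_ge_z x k); rewrite expr2 ler_wpM2r.
by apply: le_trans (z_w_weight_ge_z x j); rewrite expr2 ler_wpM2l.
Qed.

(** One variable is split off to provide the factor e. It is some z_j if there is one: removing w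
    from z_j w would leave only weight 1. *)
Lemma monomial_small a x (e : K) : (forall l, `|x 0 l| <= 1) ->
    (forall l, `|x 0 l| <= e) -> (2 < zw_weight a)%N ->
  `|monomial_at a x| <= e * z_w_weight x.
Proof.
move=> x1 xe wa.
suff [l al wl] : exists2 l, a l != 0%N & (1 < zw_weight (a - U_(l))%MM)%N.
  rewrite (mnm_splitU al) monomialMU normrM.
  by apply: ler_pM => //; apply: monomial_le_weight.
have wE l : a l != 0%N -> zw_weight a = (zw_weight U_(l) + zw_weight (a - U_(l)))%N.
  by move=> al; rewrite -zw_weightD -mnm_splitU.
have [aw|aw] := eqVneq (a (rshift n ord0)) 0%N.
  have [j aj] := zw_weight_z aw (ltnW (ltnW wa)); exists (lshift 1 j) => //.
  by move: wa; rewrite (wE _ aj) zw_weightU;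
    case: split_ordP => l /eqP; rewrite eq_shift.
have [/existsP[j aj]|] := boolP [exists j : 'I_n, a (lshift 1 j) != 0%N].
  exists (lshift 1 j) => //.
  by move: wa; rewrite (wE _ aj) zw_weightU;
    case: split_ordP => l /eqP; rewrite eq_shift.
rewrite negb_exists => /forallP a0; exists (rshift n ord0) => //.
have sum0 : (\sum_(j < n) a (lshift 1 j) = 0)%N.
  by rewrite big1 // => j _; apply/eqP; rewrite -[_ == _]negbK a0.
move: wa; rewrite {1}/zw_weight sum0 add0n => wa.
rewrite /zw_weight mnmBE mnm1E eqxx; apply: leq_trans (leq_addl _ _).
by case: (a _) wa => [|[|k]] // _; rewrite /= subn1 mulnS.
Qed.

Lemma mpoly_little_o (p : {mpoly K[n + 1]}) :
    {in msupp p, forall a, (2 < zw_weight a)%N} ->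
  little_o_z2_w (fun x => p.@[fun i => x 0 i]).
Proof.
move=> wp; rewrite /little_o_z2_w; apply/landau.eqoP => eps eps_gt0.
(* The summand 1 keeps S positive even for p = 0. *)
pose S := 1 + \sum_(a <- msupp p) `|p@_a|.
have S_gt0 : 0 < S by rewrite ltr_pwDl // sumr_ge0.
have near_lt (d : K) : 0 < d ->
      \forall x \near (0 : 'rV[K]_(n + 1)), forall l,
        `|(x : 'rV[K]_(n + 1)) 0 l| < d.
  move=> d_gt0.
  have FF : Filter (nbhs (0 : 'rV[K]_(n + 1))) by exact: nbhs_filter.
  apply: (@filter_forall _ _ (fun l x => `|x 0 l| < d) _ FF) => l.
  have cont : {for 0, continuous (fun x : 'rV[K]_(n + 1) => x 0 l)}.
    exact: coord_continuous.
  rewrite /prop_for /continuous_at mxE in cont.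
  by move/cvgr0_norm_lt: cont; apply.
near=> x.
have x1 l : `|x 0 l| <= 1 by apply/ltW; move: l; near: x; apply: near_lt.
have xe l : `|x 0 l| <= eps / S.
  by apply/ltW; move: l; near: x; apply: near_lt; rewrite divr_gt0.
rewrite [`|z_w_weight x|]ger0_norm ?z_w_weight_ge0 //.
rewrite mevalE; apply: le_trans (ler_norm_sum _ _ _) _.
apply: (@le_trans _ _ (\sum_(a <- msupp p) `|p@_a| * (eps / S * z_w_weight x))).
  rewrite big_seq [leRHS]big_seq; apply: ler_sum => a ap.
  by rewrite normrM ler_wpM2l // monomial_small // wp.
rewrite -mulr_suml mulrA ler_wpM2r ?z_w_weight_ge0 //.
rewrite mulrCA ler_piMr // ?(ltW eps_gt0) // ler_pdivrMr // mul1r.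
by rewrite /S lerDr.
Unshelve. all: by end_near.
Qed.

End LittleO.

(** * Reality of the defining series *)

Section RealSeries.
Variables (R : realType) (n : nat).
Implicit Types (G E : fps (n + n) R[i]).

Lemma fps_conj_var (l : 'I_(n + n)) :
  fps_conj (fps_var R[i] l) = fps_var R[i] (swap_bar l).
Proof.
apply: fpsP => m; have := congr1 (mcoeff m) (mpoly_conjX R[i] l).
by rewrite mcoeff_conj !mcoeffX ![U_(_)%MM == _]eq_sym.
Qed.

Lemma quadric_real (lambda : 'I_n -> R) : real_valued (quadric lambda).
Proof.
have conj_z (j : 'I_n) : fps_conj (z_ R j) = zbar_ R j.
  by rewrite /z_ fps_conj_var swap_bar_lshift.
have conj_zbar (j : 'I_n) : fps_conj (zbar_ R j) = z_ R j.
  by rewrite /zbar_ fps_conj_var swap_bar_rshift.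
rewrite /real_valued rmorph_sum; apply: eq_bigr => j _.
rewrite rmorphD rmorphM /= fps_conjZ rmorphD !rmorphXn /= conj_z conj_zbar.
rewrite [z_ R j * _]mulrC [z_ R j ^+ 2 + _]addrC; congr (_ + _ *: _).
by apply/CrealP; rewrite complex_real.
Qed.

Lemma fps_Im_real G E :
  real_valued G -> real_valued E -> fps_Im (G + 'i *: E) = E.
Proof.
move=> realG realE; rewrite /fps_Im rmorphD /= fps_conjZ realG realE conjCi.
rewrite scaleNr opprD opprK addrACA subrr add0r -scalerDl scalerA.
have -> : 'i + 'i = 2 * 'i :> R[i] by rewrite mulrDl mul1r.
by rewrite mulVf ?scale1r // two_i_neq0.
Qed.

End RealSeries.

Theorem theorem3p2 (R : realType) (n : nat) (n_gt1 : (1 < n)%N)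
    (lambda : 'I_n -> R) (p E : fps (n + n) R[i])
    (lambda_ge0 : forall i : 'I_n, 0 <= lambda i)
    (p_real : real_valued p) (E_real : real_valued E)
    (p_order : fps_order_ge 3 p) (E_order : fps_order_ge 3 E)
    (lambda_neq_half : exists i : 'I_n, lambda i <> 2^-1)
    (nonminimal : formally_non_minimal n_gt1 (quadric lambda + p) E)
    (N : nat) (N_gt0 : (0 < N)%N) :
  exists (F : 'rV[R[i]]_(n + 1) -> R[i]) (f : fps (n + 1) R[i])
         (rho : fps (n + n) R[i]),
    [/\ has_taylor_series F f,
        little_o_z2_w F,
        transformed_equation (quadric lambda + p + 'i *: E) f rho
      & fps_order_ge N (fps_Im rho)].
Proof.
have lt3 (f : fps (n + n) R[i]) : fps_order_ge 3 f -> leading 2 f 0.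
  by move/leading_trunc/leading_lt; apply.
have lead : leading 2 (quadric lambda + p + 'i *: E) (qq (lam lambda)).
  have := leadingD (leadingD (leading_quadric lambda) (lt3 _ p_order))
    (leadingZ 'i (lt3 _ E_order)).
  by rewrite scaler0 !addr0.
have realG : real_valued (quadric lambda + p).
  by rewrite /real_valued rmorphD /= quadric_real p_real.
have nm := formally_non_minimalP lambda_ge0 realG E_real lead nonminimal.
have ImE := fps_Im_real realG E_real.
set phi := _ + 'i *: E in lead nm ImE *.
have [|P wP ordP] := flatten_order lambda_ge0 lambda_neq_half N lead nm.
  by rewrite ImE.
exists (fun x => P.@[fun i => x 0 i]), (mpoly_fps P), (phi + at_graph phi P).
split.
- exact: mpoly_has_taylor_series.
- exact: mpoly_little_o.
- rewrite /transformed_equation restrict_to_graphE //.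
  exact: leading_lt lead _.
- by move=> m lt_mN; apply: ordP; rewrite ltn_addr.
Qed.
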